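(* Suppose that the following condition is satisfied: $\mathfrak{X}$ has a compatible metric $\mathfrak{d}$ under which there exists a decreasing sequence $(\delta_n)_n$ of strictly positive numbers such that $\inf_n\delta_n=0$, $\mathfrak{m}\{y\in\mathfrak{X}:\mathfrak{d}(x,y)=\delta_n\}=0$ for every $n$ and every $x\in\mathfrak{X}$, and $\mathfrak{m}(\mathcal{B}_{x,\delta_n})=\mathfrak{m}(\mathcal{B}_{y,\delta_n})$ for every $n$ and every $x,y\in\mathfrak{X}$. Let $E$ be a Banach $\mathcal{M}$-bimodule such that its module operation $\diamond:\mathcal{M}\otimes E\otimes\mathcal{M}\to E$, $a\otimes\omega\otimes b\mapsto a\diamond\omega\diamond b$, is continuous with respect to the injective tensor norm, and such that for every two-sided norm-approximate unit $(\mathcal{E}_n)_n$ of $\mathcal{M}$ (indexed as a sequence) we have $\mathcal{E}_n\diamond\omega\to\omega$ for every $\omega\in E$. Then any bounded derivation from $\mathcal{M}$ to $E$ is sequentially approximately inner.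
   Context: $\mathfrak{X}$ is a fixed compact metrizable space and $\mathfrak{m}$ is a fixed Borel probability measure on $\mathfrak{X}$ whose support is all of $\mathfrak{X}$. $\mathcal{M}=\mathcal{M}_{\mathfrak{X},\mathfrak{m}}$ denotes the Banach $*$-algebra $\mathbf{C}(\mathfrak{X}^2)$ of continuous complex functions on $\mathfrak{X}\times\mathfrak{X}$ with the supremum norm, the multiplication $(f\star g)(x,y)=\int_{\mathfrak{X}}f(x,z)g(z,y)\,d\mathfrak{m}(z)$ and the involution $f^*(x,y)=\overline{f(y,x)}$. A compatible metric is one inducing the topology of $\mathfrak{X}$, and $\mathcal{B}_{x,\delta}$ is the open $\mathfrak{d}$-ball with center $x$ and radius $\delta$. A two-sided norm-approximate unit of $\mathcal{M}$ is a net $(u_\lambda)_\lambda$ in $\mathcal{M}$ such that $a\star u_\lambda\to a$ and $u_\lambda\star a\to a$ in norm for every $a\in\mathcal{M}$ (no boundedness required). A Banach $A$-bimodule over a Banach algebra $A$ is a Banach space that is an algebraic $A$-bimodule with bounded bilinear left and right actions. A (bounded) derivation from $A$ to a Banach $A$-bimodule $E$ is a (bounded) linear map $D:A\to E$ with $D(ab)=aD(b)+D(a)b$ for all $a,b\in A$. $D$ is sequentially approximately inner if there is a sequence $(\omega_n)_n$ in $E$ such that $D(a)=\lim_n(a\omega_n-\omega_n a)$ in norm for every $a\in A$. *)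

(* Defs.v *)
From HB Require Import structures.
From mathcomp Require Import all_boot all_order all_algebra.
From mathcomp Require Import complex.
From mathcomp Require Import all_classical all_reals all_analysis.
Set Implicit Arguments.
Unset Strict Implicit.
Unset Printing Implicit Defensive.
Import Order.TTheory GRing.Theory Num.Theory.
Import numFieldNormedType.Exports.
Local Open Scope classical_set_scope.
Local Open Scope complex_scope.
Local Open Scope ring_scope.

(* all_algebra's Re and Im are those of numClosedFieldType, valued in R[i] *)
Local Notation Re := complex.Re.
Local Notation Im := complex.Im.

Notation borel X := (g_sigma_algebraType (@open X)).

Section complex_norm.
Context {R : realType}.
Implicit Types z w : R[i].

Lemma Re_normE z : `|z| = (Re `|z|)%:C.
Proof. by rewrite RRe_real// normr_real. Qed.

Lemma Re_norm_ge0 z : 0 <= Re `|z|.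
Proof. by rewrite -ler0c -Re_normE. Qed.

Lemma Re_normD z w : Re `|z + w| <= Re `|z| + Re `|w|.
Proof. by rewrite -lecR rmorphD/= -!Re_normE; exact: ler_normD. Qed.

Lemma Re_normM z w : Re `|z * w| = Re `|z| * Re `|w|.
Proof. by apply: complexI; rewrite rmorphM/= -!Re_normE normrM. Qed.

Lemma Re_norm_eq0 z : Re `|z| = 0 -> z = 0.
Proof. by move=> z0; apply/normr0_eq0; rewrite Re_normE z0. Qed.

Lemma normRe_le z : `|Re z| <= Re `|z|.
Proof. by rewrite -lecR -Re_normE; exact: normc_ge_Re. Qed.

Lemma normIm_le z : `|Im z| <= Re `|z|.
Proof.
case: z => a b; rewrite normc_def/=.
by rewrite -[leLHS]sqrtr_sqr ler_wsqrtr// lerDr sqr_ge0.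
Qed.

Lemma Re_norm_le z : Re `|z| <= `|Re z| + `|Im z|.
Proof.
case: z => a b; rewrite normc_def/= -[leRHS]ger0_norm ?addr_ge0//.
rewrite -sqrtr_sqr ler_wsqrtr// sqrrD !real_normK ?num_real//.
by rewrite -addrA lerD2l lerDr mulrn_wge0// mulr_ge0.
Qed.

End complex_norm.

Section complex_continuity.
Context {R : realType} {T : topologicalType}.
Implicit Types f g : T -> R[i]^o.

Lemma lipschitz_continuous (phi : R[i] -> R) f :
  (forall z w, `|phi z - phi w| <= Re `|z - w|) ->
  continuous f -> continuous (fun t => phi (f t)).
Proof.
move=> lip cf t; apply/cvgrPdist_lt => /= e e0.
have e0' : 0 < e%:C by rewrite ltcR.
near=> s; rewrite -ltcR; apply: le_lt_trans (_ : `|f t - f s| < _).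
  by rewrite (Re_normE (f t - f s)) lecR; exact: lip.
by near: s; apply: cvgr_dist_lt => //; exact: cf.
Unshelve. all: by end_near. Qed.

Lemma continuous_Re f : continuous f -> continuous (fun t => Re (f t)).
Proof.
by apply: lipschitz_continuous => z w; rewrite -raddfB; exact: normRe_le.
Qed.

Lemma continuous_Im f : continuous f -> continuous (fun t => Im (f t)).
Proof.
by apply: lipschitz_continuous => z w; rewrite -raddfB; exact: normIm_le.
Qed.

Lemma continuous_Re_norm f : continuous f -> continuous (fun t => Re `|f t|).
Proof.
apply: (@lipschitz_continuous (fun z => Re `|z|)) => z w.
have wz : Re `|w - z| = Re `|z - w| by rewrite distrC.
have := Re_normD (w - z) z; have := Re_normD (z - w) w; rewrite wz !subrK.
by rewrite ler_distl lerBlDr (addrC (Re `|w|)) (addrC (Re `|z|)) => -> ->.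
Qed.

Lemma continuous_complex (u v : T -> R) : continuous u -> continuous v ->
  continuous (fun t => u t +i* v t : R[i]^o).
Proof.
move=> cu cv t; apply/cvgrPdist_lt => /= e e0.
have eE : e = (Re e)%:C by rewrite RRe_real// gtr0_real.
have {}e0 : 0 < Re e by rewrite -ltcR -eE.
have e20 : 0 < Re e / 2 by rewrite divr_gt0.
near=> s; rewrite [ltRHS]eE Re_normE ltcR (le_lt_trans (Re_norm_le _))//=.
rewrite [ltRHS]splitr ltrD//.
  by near: s; apply: cvgr_dist_lt => //; exact: cu.
by near: s; apply: cvgr_dist_lt => //; exact: cv.
Unshelve. all: by end_near. Qed.

End complex_continuity.

Section parameter_integral.
Context {R : realType} {X : ptopologicalType}.
Hypothesis cX : compact [set: X].
Variable m : probability (borel X) R.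

Lemma continuous_borel_measurable (h : X -> R) :
  continuous h -> measurable_fun [set: borel X] (h : borel X -> R).
Proof.
move=> ch; apply: (measurability _ (measurable_realfun.RGenOpens.measurableE R)).
move=> _ [_ [a [b ->]] <-]; rewrite setTI; apply: sub_sigma_algebra.
by move/continuousP : ch; apply; exact: interval_open.
Qed.

Lemma continuous_compact_integrable (h : X -> R) : continuous h ->
  m.-integrable [set: borel X] (EFin \o (h : borel X -> R)).
Proof.
move=> ch; apply: measurable_bounded_integrable => //.
- by rewrite [X in (X < _)%E](probability_setT m) ltry.
- exact: continuous_borel_measurable.
- have /compact_bounded[B [Br hB]] : compact (h @` [set: X]).
    by apply: continuous_compact => //; exact: continuous_subspaceT.
  by exists B; split=> // M BM x _; apply: hB => //; exists x.
Qed.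

Lemma continuous_parameter_Rintegral (T : topologicalType) (h : T * X -> R) :
  continuous h ->
  continuous (fun t => \int[m]_(z in [set: borel X]) h (t, z)).
Proof.
move=> ch t.
have cht s : continuous (fun z => h (s, z)).
  move=> z; apply: (@continuous_comp _ _ _ (fun z => (s, z)) h); last exact: ch.
  by apply: cvg_pair => /=; [exact: cvg_cst|exact: cvg_id].
apply/cvgrPdist_le => /= e e0.
have e20 : 0 < e / 2 by rewrite divr_gt0.
have near_unif : \forall s \near t, [set: X] `<=`
    (fun z => `|h (t, z) - h (s, z)| <= e).
  apply: (compact_near_coveringP _).1 cX _ _ _ _ _ => x _.
  have [/= [U V] [Ux Vt] UV] : nbhs (t, x) [set p | `|h (t, x) - h p| < e / 2].
    by have /cvgrPdist_lt := ch (t, x); apply.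
  exists (V, U) => //= -[z s] /= [Vz Us].
  rewrite [leRHS]splitr.
  rewrite -(subrKA (h (t, x))) (le_trans (ler_normD _ _))// lerD//.
    rewrite distrC ltW//; apply: (UV (t, z)); split => //=.
    exact: nbhs_singleton.
  by apply: ltW; apply: (UV (s, z)).
near=> s.
have hs : [set: X] `<=` (fun z => `|h (t, z) - h (s, z)| <= e) by near: s.
rewrite -RintegralB//; [|exact: continuous_compact_integrable..].
have cts : continuous (fun z => h (t, z) - h (s, z)).
  by move=> z; apply: cvgB; exact: cht.
apply: (le_trans (le_normr_Rintegral _ _)) => //.
  exact: continuous_compact_integrable.
apply: (@le_trans _ _ (\int[m]_(z in [set: borel X]) e)).
  apply: le_Rintegral => //.
  - apply: continuous_compact_integrable => z.
    by apply: (continuous_comp (cts z)); exact: norm_continuous.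
  - by apply: continuous_compact_integrable => z; exact: cvg_cst.
rewrite (Rintegral_cst _ measurableT).
rewrite [X in _ * fine X](_ : _ = 1%E) ?mulr1//; exact: probability_setT.
Unshelve. all: by end_near. Qed.

End parameter_integral.

Section kernel_algebra.
Context {R : realType} {X : ptopologicalType}.

Definition continuous_kernel : {pred (X * X)%type -> R[i]^o} :=
  fun f => `[< continuous f >].

Lemma continuous_kernel_submod_closed : submod_closed continuous_kernel.
Proof.
split; first by apply/asboolP => x; exact: cvg_cst.
move=> a f g /asboolP cf /asboolP cg; apply/asboolP => x.
by apply: cvgD; [apply: cvgZr; exact: cf|exact: cg].
Qed.

HB.instance Definition _ := GRing.isSubmodClosed.Build R[i] _ continuous_kernel
  continuous_kernel_submod_closed.

(* Complex Banach spaces are completeNormedModType R[i]: the norm takes values in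
   the nonnegative reals of R[i].  R[i]^o is C as a normed space over itself. *)

(* The measure only enters through the product, and compactness through the
   norm; both are parameters of the type so that they can be inferred. *)
Record kernel_algebra (cX : compact [set: X]) (m : probability (borel X) R) :=
  Kernel {
    kernel_fun :> (X * X)%type -> R[i]^o;
    kernel_funP : kernel_fun \in continuous_kernel }.

Variables (cX : compact [set: X]) (m : probability (borel X) R).
Local Notation M := (kernel_algebra cX m).
Implicit Types f g : M.

HB.instance Definition _ := [isSub for @kernel_fun cX m].
HB.instance Definition _ := [Choice of M by <:].
HB.instance Definition _ := [SubChoice_isSubLmodule of M by <:].

Lemma kernel_continuous f : continuous f.
Proof. exact/asboolP/(kernel_funP f). Qed.

Definition kernel_norm f : R[i] :=
  (sup [set Re `|f p| | p in [set: X * X]])%:C.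

Lemma kernel_has_sup f : has_sup [set Re `|f p| | p in [set: X * X]].
Proof.
apply: compact_has_sup; first by exists (Re `|f point|), point.
apply: continuous_compact.
  by apply: continuous_subspaceT; exact/continuous_Re_norm/kernel_continuous.
by rewrite -setXTT; exact: compact_setX.
Qed.

Lemma kernel_norm_ge f p : Re `|f p| <= Re (kernel_norm f).
Proof. by apply: ub_le_sup; [case: (kernel_has_sup f)|exists p]. Qed.

Lemma kernel_norm_le f (c : R) :
  (forall p, Re `|f p| <= c) -> kernel_norm f <= c%:C.
Proof.
move=> fc; rewrite lecR; apply: ge_sup; first by case: (kernel_has_sup f).
by move=> _ [p _ <-].
Qed.

Lemma kernel_normE f : kernel_norm f = (Re (kernel_norm f))%:C.
Proof. by []. Qed.

Lemma kernel_norm_triangle f g :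
  kernel_norm (f + g) <= kernel_norm f + kernel_norm g.
Proof.
rewrite (kernel_normE f) (kernel_normE g) -rmorphD; apply: kernel_norm_le => p.
by apply: (le_trans (Re_normD _ _)); rewrite lerD// kernel_norm_ge.
Qed.

Lemma kernel_normZ_le (a : R[i]) f :
  kernel_norm (a *: f) <= `|a| * kernel_norm f.
Proof.
rewrite (Re_normE a) (kernel_normE f) -rmorphM; apply: kernel_norm_le => p.
by rewrite [X in `|X|]/(a * f p) Re_normM ler_wpM2l ?Re_norm_ge0 ?kernel_norm_ge.
Qed.

Lemma kernel_normZ (a : R[i]) f : kernel_norm (a *: f) = `|a| * kernel_norm f.
Proof.
apply/eqP; rewrite eq_le kernel_normZ_le/=.
have [->|a0] := eqVneq a 0.
  rewrite normr0 mul0r scale0r lecR.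
  exact: le_trans (Re_norm_ge0 _) (kernel_norm_ge 0 point).
rewrite -ler_pdivlMl ?normr_gt0// -normfV.
by have := kernel_normZ_le a^-1 (a *: f); rewrite scalerA mulVf// scale1r.
Qed.

Lemma kernel_norm_eq0 f : kernel_norm f = 0 -> f = 0.
Proof.
move=> f0; apply/val_inj/funext => p; apply: Re_norm_eq0; apply/eqP.
rewrite eq_le Re_norm_ge0 andbT; apply: (le_trans (kernel_norm_ge f p)).
by rewrite f0.
Qed.

HB.instance Definition _ := Lmodule_isNormed.Build R[i] M
  kernel_norm_triangle kernel_normZ kernel_norm_eq0.

Lemma kernel_algebra_normE f : `|f| = kernel_norm f.
Proof. by []. Qed.

Definition kernel_mul_fun f g (p : X * X) : R[i]^o :=
  (\int[m]_(z in [set: borel X]) Re (f (p.1, z) * g (z, p.2))) +i*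
  (\int[m]_(z in [set: borel X]) Im (f (p.1, z) * g (z, p.2))).

Lemma kernel_mul_funP f g : kernel_mul_fun f g \in continuous_kernel.
Proof.
apply/asboolP.
have cfg : continuous
    (fun q : (X * X) * X => f (q.1.1, q.2) * g (q.2, q.1.2) : R[i]^o).
  move=> q; apply: cvgM.
    apply: (@continuous_comp _ _ _ (fun q : (X * X) * X => (q.1.1, q.2)) f).
      apply: cvg_pair; last exact: cvg_snd.
      by apply: cvg_comp; [exact: cvg_fst|exact: cvg_fst].
    exact: kernel_continuous.
  apply: (@continuous_comp _ _ _ (fun q : (X * X) * X => (q.2, q.1.2)) g).
    apply: cvg_pair; first exact: cvg_snd.
    by apply: cvg_comp; [exact: cvg_fst|exact: cvg_snd].
  exact: kernel_continuous.
apply: continuous_complex.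
  by have := @continuous_parameter_Rintegral R X cX m (X * X)%type _ (continuous_Re cfg).
by have := @continuous_parameter_Rintegral R X cX m (X * X)%type _ (continuous_Im cfg).
Qed.

Definition kernel_mul f g : M := Kernel cX m (kernel_mul_funP f g).

End kernel_algebra.

Section banach_bimodules.
Context {R : realType} {A : normedModType R[i]} (mulA : A -> A -> A).

Definition approximate_unit_seq (u : nat -> A) := forall a : A,
  (mulA a (u n) @[n --> \oo] --> a) /\ (mulA (u n) a @[n --> \oo] --> a).

Record banach_bimodule (E : completeNormedModType R[i]) := BanachBimodule {
  lact : {bilinear A -> E -> E};
  ract : {bilinear E -> A -> E};
  lactA : forall a b w, lact (mulA a b) w = lact a (lact b w);
  ractA : forall a b w, ract w (mulA a b) = ract (ract w a) b;
  lractA : forall a b w, ract (lact a w) b = lact a (ract w b);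
  lact_bounded : exists c : R, forall a w, `|lact a w| <= c%:C * `|a| * `|w|;
  ract_bounded : exists c : R, forall a w, `|ract w a| <= c%:C * `|w| * `|a| }.

Variables (E : completeNormedModType R[i]) (B : banach_bimodule E).

Definition derivation (D : {linear A -> E}) :=
  forall a b, D (mulA a b) = lact B a (D b) + ract B (D a) b.

Definition bounded_operator (D : {linear A -> E}) :=
  exists c : R, forall a, `|D a| <= c%:C * `|a|.

Definition sequentially_approximately_inner (D : A -> E) :=
  exists w : nat -> E,
    forall a, (lact B a (w n) - ract B (w n) a) @[n --> \oo] --> D a.

End banach_bimodules.

Section injective_tensor_norm.
Context {R : realType}.

Definition dual_ball (V : normedModType R[i]) : set {linear V -> R[i]^o} :=
  [set phi | forall v, `|phi v| <= `|v|].

(* Injective norm of the element \sum_(s <- t) s.1.1 (x) s.1.2 (x) s.2 of the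
   algebraic tensor product U (x) V (x) W.  It is computed from an arbitrary
   representation t as a sum of elementary tensors: the value at
   phi (x) xi (x) psi depends only on the tensor that t represents. *)
Definition injective_norm (U V W : normedModType R[i]) (t : seq (U * V * W)) : R :=
  sup [set r | exists (phi : {linear U -> R[i]^o}) (xi : {linear V -> R[i]^o})
                      (psi : {linear W -> R[i]^o}),
    [/\ dual_ball phi, dual_ball xi, dual_ball psi &
        r = Re `|\sum_(s <- t) phi s.1.1 * xi s.1.2 * psi s.2 : R[i]| ]].

(* Continuity of the linear map U (x) V (x) W -> E induced by a trilinear map
   b, with respect to the injective norm. *)
Definition injectively_continuous (U V W E : normedModType R[i])
    (b : U -> V -> W -> E) :=
  exists c : R, forall t : seq (U * V * W),
    `|\sum_(s <- t) b s.1.1 s.1.2 s.2| <= (c * injective_norm t)%:C.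

End injective_tensor_norm.

Section metric_measure.
Context {R : realType} {X : ptopologicalType}.

Definition compatible_metric (d : X -> X -> R) :=
  [/\ forall x y, d x y = 0 <-> x = y,
      forall x y, d x y = d y x,
      forall x y z, d x z <= d x y + d y z &
      forall x (A : set X),
        nbhs x A <-> exists2 e, 0 < e & [set y | d x y < e] `<=` A].

Definition measure_support (m : probability (borel X) R) : set X :=
  [set x | forall U : set X, open U -> U x -> (0 < m U)%E].

(* nonincreasing_seq is the non-strict reading of "decreasing"; positivity and
   infimum 0 give a strictly decreasing subsequence with the same properties. *)
Definition homogeneous_radii (m : probability (borel X) R) (d : X -> X -> R)
    (delta : nat -> R) :=
  [/\ nonincreasing_seq delta,
      forall n, 0 < delta n,
      inf (range delta) = 0,
      forall n x, m [set y | d x y = delta n] = 0%E &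
      forall n x y, m [set z | d x z < delta n] = m [set z | d y z < delta n]].

End metric_measure.

(* Main.v *)
(* Write f (x) 1 and 1 (x) g for the kernels f(x) and g(y); their product in the
   algebra is f (x) g.  For a finite-rank kernel u = sum_i f_i (x) g_i put
   w = sum_i (f_i (x) 1) D(1 (x) g_i), the discrete analogue of the matrix-unit
   formula for the implementing element of a derivation.  The Leibniz rule gives
     [c, w] = Lambda([c, u]) + u D(c),
   where Lambda(f (x) g) = (f (x) 1) D(1 (x) g), so everything follows from an
   approximate unit of finite-rank kernels and a bound of Lambda by the supremum
   norm.  As D(f (x) g) = Lambda(f (x) g) + D(f (x) 1)(1 (x) g), it suffices to
   bound Upsilon(f (x) g) = D(f (x) 1)(1 (x) g), whereas the hypothesis
   on injective norms controls only a w b, and inserting a = u on the left costs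
   the unbounded factor ||u||.

   Two facts give the bound.  First, unit_cvg holds for every approximate unit,
   hence survives small perturbations in the multiplier norm, and the uniform
   boundedness principle bounds the left action by the multiplier norm.  Second,
   for u = sum_l p_l (x) q_l,
     tr(u) u = sum_(l,j) (p_l (x) q_j) * (p_j (x) q_l),
   so tr(u) u Upsilon(t) is a sum of triple products whose injective norm is at
   most a constant times ||u|| times the multiplier norm of u.  Since
   homogeneity of the radii yields kernels u_n close to the indicator of
   d < delta_n divided by the common ball mass, with ||u_n|| <= 4 |tr(u_n)|,
   the unbounded factors cancel. *)
Require Import Defs.
From HB Require Import structures.
From mathcomp Require Import all_boot all_order all_algebra.
From mathcomp Require Import complex lra ring.
From mathcomp Require Import all_classical all_reals all_analysis.
From mathcomp Require Import measurable_realfun.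
Set Implicit Arguments.
Unset Strict Implicit.
Unset Printing Implicit Defensive.
Import Order.TTheory GRing.Theory Num.Theory.
Import numFieldNormedType.Exports.
Local Open Scope classical_set_scope.
Local Open Scope complex_scope.
Local Open Scope ring_scope.

Local Notation Re := complex.Re.
Local Notation Im := complex.Im.
Local Notation "f ** g" := (kernel_mul f g) (at level 40, left associativity).

#[local] Arguments kernel_mul : simpl never.

(** * Real-valued norms and uniform boundedness *)

Section real_norm.
Context {R : realType} {V : normedModType R[i]}.
Implicit Types (u v : V) (c : R).

(** Norms are values in [R[i]]; their real part loses nothing and gives estimates in the totally
    ordered field [R], where [lra] applies. *)
Definition rnorm (v : V) : R := Re `|v|.

Lemma rnormE v : `|v| = (rnorm v)%:C.
Proof. by rewrite RRe_real// normr_real. Qed.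

Lemma rnorm_le v c : (`|v| <= c%:C) = (rnorm v <= c).
Proof. by rewrite rnormE lecR. Qed.

Lemma rnorm_ge0 v : 0 <= rnorm v.
Proof. by rewrite -ler0c -rnormE. Qed.

Lemma rnormD u v : rnorm (u + v) <= rnorm u + rnorm v.
Proof. by rewrite -rnorm_le rmorphD/= -!rnormE ler_normD. Qed.

Lemma rnormN v : rnorm (- v) = rnorm v.
Proof. by rewrite /rnorm normrN. Qed.

Lemma rdistrC u v : rnorm (u - v) = rnorm (v - u).
Proof. by rewrite /rnorm distrC. Qed.

Lemma rnormB u v : rnorm (u - v) <= rnorm u + rnorm v.
Proof. by rewrite -(rnormN v) rnormD. Qed.

Lemma rnormZ (a : R[i]) v : rnorm (a *: v) = Re `|a| * rnorm v.
Proof.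
by apply: complexI; rewrite rmorphM/= -Re_normE -!rnormE normrZ.
Qed.

Lemma rnorm0 : rnorm 0 = 0.
Proof. by rewrite /rnorm normr0. Qed.

Lemma rnorm_gt0 v : v != 0 -> 0 < rnorm v.
Proof. by rewrite -ltcR -rnormE normr_gt0. Qed.

Lemma cvg_rnormP (u : nat -> V) (l : V) :
  u n @[n --> \oo] --> l <->
  forall e, 0 < e -> exists N, forall n, (N <= n)%N -> rnorm (u n - l) <= e.
Proof.
split=> [/cvgrPdist_le ul e e0|ul].
  have [|N _ uN] := ul e%:C; first by rewrite ltcR.
  by exists N => n Nn; rewrite -rnorm_le distrC; exact: uN.
apply/cvgrPdist_le => /= e e0.
have eE : e = (Re e)%:C by rewrite RRe_real// gtr0_real.
have [|N uN] := ul (Re e); first by rewrite -ltcR -eE.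
by exists N => //= n Nn; rewrite eE distrC rnorm_le; exact: uN.
Qed.

End real_norm.

Section uniform_boundedness.
Context {R : realType}.

(** Halving gives [r n <= 2 * r n - 2 * r n.+1], so the displacements telescope. The conclusion says
    that the limit lies in every ball of doubled radius, which is the form a nested-ball argument
    uses. *)
Lemma geometric_cauchy_cvg (E : completeNormedModType R[i]) (x : nat -> E)
    (r : nat -> R) :
  (forall n, 0 < r n) -> (forall n, r n.+1 <= r n / 2) ->
  (forall n, rnorm (x n.+1 - x n) <= r n) ->
  exists l, forall n, rnorm (l - x n) <= 2 * r n.
Proof.
move=> r0 r2 xr.
have xx n k : rnorm (x (n + k)%N - x n) <= 2 * r n - 2 * r (n + k)%N.
  elim: k => [|k IH]; first by rewrite addn0 !subrr rnorm0.
  rewrite addnS -(subrKA (x (n + k)%N)) (le_trans (rnormD _ _))//.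
  have := r2 (n + k)%N; have := xr (n + k)%N; lra.
have rn n : r n <= r 0%N / 2 ^+ n.
  elim: n => [|n IH]; first by rewrite expr0 divr1.
  by rewrite (le_trans (r2 n))// exprSr invfM mulrA ler_pM2r// invr_gt0.
have r_small e : 0 < e -> exists n, r n <= e.
  move=> e0; have := @cvg_geometric R (r 0%N) 2^-1.
  rewrite ger0_norm ?invr_ge0// invf_lt1// ltr1n => /(_ isT).
  move=> /cvgrPdist_le /(_ e e0)[n _ /(_ n (leqnn n))].
  rewrite /= sub0r normrN => rne; exists n; apply: (le_trans (rn n)).
  by rewrite -exprVn (le_trans (ler_norm _))//.
have cx : cauchy (x n @[n --> \oo]).
  apply/cauchyP => /= e e0; have eE : e = (Re e)%:C.
    by rewrite RRe_real// gtr0_real.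
  have {}e0 : 0 < Re e by rewrite -ltcR -eE.
  have [|n rne] := r_small (Re e / 4); first by rewrite divr_gt0.
  exists (x n); exists n => //= m nm.
  rewrite -ball_normE/= eE rnormE ltcR rdistrC -(subnKC nm).
  by have := xx n (m - n)%N; have := r0 (n + (m - n))%N; lra.
have /cvg_ex[/= l xl] : cvg (x n @[n --> \oo]) by exact: cauchy_cvg.
exists l => n; rewrite leNgt; apply/negP => lt.
have /cvg_rnormP/(_ ((rnorm (l - x n) - 2 * r n) / 2)) := xl.
case=> [|N /(_ (n + N)%N (leq_addl _ _))]; first by rewrite divr_gt0// subr_gt0.
have := xx n N; have := r0 (n + N)%N.
have := rnormD (l - x (n + N)%N) (x (n + N)%N - x n).
rewrite subrKA (rdistrC l (x (n + N)%N)); lra.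
Qed.

(* The Banach-Steinhaus theorem of the library is over a realType, and the
   scalars here are R[i]. *)
Lemma uniform_boundedness (I : Type) (E : completeNormedModType R[i])
    (W : normedModType R[i]) (T : I -> E -> W) :
  (forall i, linear (T i)) ->
  (forall i, exists c, forall x, rnorm (T i x) <= c * rnorm x) ->
  (forall x, exists c, forall i, rnorm (T i x) <= c) ->
  exists2 c, 0 < c & forall i x, rnorm (T i x) <= c * rnorm x.
Proof.
move=> linT bT pT; apply: contrapT => nT.
have big c : 0 < c -> exists i x, c * rnorm x < rnorm (T i x).
  move=> c0; apply: contrapT => H; apply: nT; exists c => // i x.
  by rewrite leNgt; apply/negP => h; apply: H; exists i, x.
(* A pair is a ball. The new center stays within the old radius, and some [T i] is at least [n] on
   the doubled new ball, the one known to contain the limit. *)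
have step (n : nat) (p : E * {posnum R}) : exists q : E * {posnum R},
    [/\ rnorm (q.1 - p.1) <= p.2%:num, q.2%:num <= p.2%:num / 2 &
        exists i, forall z, rnorm (z - q.1) <= 2 * q.2%:num ->
          n%:R <= rnorm (T i z)].
  case: p => x r /=.
  have Kr : 0 < n.+1%:R / r%:num by rewrite divr_gt0.
  have [i [y yT]] := big _ Kr.
  have TB a b : T i (a - b) = T i a - T i b.
    by have := linT i (-1) b a; rewrite !scaleN1r !(addrC (- _)).
  have TD a b : T i (a + b) = T i a + T i b.
    by have := linT i 1 a b; rewrite !scale1r.
  have T0 : T i 0 = 0 by have := TB 0 0; rewrite !subrr.
  have y0 : 0 < rnorm y.
    rewrite rnorm_gt0//; apply/eqP => y0; move: yT; rewrite y0 rnorm0 mulr0.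
    by rewrite T0 rnorm0 ltxx.
  pose y' := ((r%:num / rnorm y)%:C : R[i]) *: y.
  have sc : Re `|((r%:num / rnorm y)%:C : R[i])| = r%:num / rnorm y.
    by rewrite ger0_norm ?ler0c//= divr_ge0// ltW.
  have y'r : rnorm y' = r%:num.
    by rewrite /y' rnormZ sc divfK// gt_eqF.
  have Ty' : n.+1%:R < rnorm (T i y').
    rewrite /y'; have := linT i (r%:num / rnorm y)%:C y 0.
    rewrite !addr0 T0 addr0 => ->; rewrite rnormZ sc.
    rewrite -ltr_pdivrMl ?divr_gt0// invf_div.
    by rewrite (le_lt_trans _ yT)// mulrC mulrA mulrAC.
  (* The values of [T i] at [x + y'] and [x - y'] differ by [2 *: T i y'], so they cannot both have
     norm at most [n.+1]. *)
  have [x' x'x Tx'] : exists2 x', rnorm (x' - x) <= r%:num &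
      n.+1%:R < rnorm (T i x').
    have [h|h] := ltP n.+1%:R (rnorm (T i (x + y'))).
      by exists (x + y') => //; rewrite addrAC subrr add0r y'r.
    exists (x - y'); first by rewrite addrAC subrr add0r rnormN y'r.
    have := rnormB (T i (x + y')) (T i (x - y')).
    have -> : T i (x + y') - T i (x - y') = (2%:R : R[i]) *: T i y'.
      by rewrite TD TB opprB addrC addrA subrK scaler_nat mulr2n.
    rewrite rnormZ normr_nat.
    have -> : Re (2%:R : R[i]) = 2 by rewrite -(rmorph_nat (real_complex R)).
    lra.
  have [c cT] := bT i.
  pose c' := Num.max 1 c.
  have c'0 : 0 < c' by rewrite lt_max ltr01.
  (* Within twice this radius [T i] varies by at most 1, which is the drop from [n.+1] to [n]. *)
  have r'0 : 0 < Num.min (r%:num / 2) (1 / (2 * c')).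
    by rewrite lt_min divr_gt0//= divr_gt0// mulr_gt0.
  exists (x', PosNum r'0); split => //=; first by rewrite ge_min lexx.
  exists i => z zx'.
  have : rnorm (T i (z - x')) <= 1.
    rewrite (le_trans (cT _))// (@le_trans _ _ (c' * rnorm (z - x')))//.
      by rewrite ler_wpM2r ?rnorm_ge0// le_max lexx orbT.
    rewrite -ler_pdivlMl// (le_trans zx')// -ler_pdivlMl//.
    by rewrite ge_min mulr1 div1r invfM lexx orbT.
  rewrite TB; have := rnormB (T i z) (T i z - T i x').
  by rewrite subKr -(natr1 n) in Tx' *; lra.
have [next nextP] : exists next : nat -> E * {posnum R} -> E * {posnum R},
    forall n p, [/\ rnorm ((next n p).1 - p.1) <= p.2%:num,
        (next n p).2%:num <= p.2%:num / 2 &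
        exists i, forall z, rnorm (z - (next n p).1) <= 2 * (next n p).2%:num ->
          n%:R <= rnorm (T i z)].
  exists (fun n => projT1 (choice (step n))) => n.
  exact: (projT2 (choice (step n))).
pose p := fix p n := if n is n'.+1 then next n' (p n') else (0, PosNum ltr01).
have [l lP] : exists l, forall n, rnorm (l - (p n).1) <= 2 * (p n).2%:num.
  apply: (@geometric_cauchy_cvg E (fst \o p) (fun n => (p n).2%:num)) => n //.
    by case: (nextP n (p n)).
  by case: (nextP n (p n)).
have [c cT] := pT l.
(* The limit [l] lies in the ball built at a stage whose lower bound exceeds the supposed pointwise
   bound [c]. *)
have [_ _ [i /(_ l (lP (Num.truncn c).+2))]] :=
  nextP (Num.truncn c).+1 (p (Num.truncn c).+1).
apply/negP; rewrite -ltNge (le_lt_trans (cT i))//.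
by rewrite truncnS_gt.
Qed.

End uniform_boundedness.

(** * Complex integrals and the kernel algebra *)

Section complex_integral.
Context {R : realType} {X : ptopologicalType}.
Variables (cX : compact [set: X]) (m : probability (borel X) R).
Implicit Types (h g : X -> R[i]^o) (u v : X -> R).

Definition rint u : R := \int[m]_(z in [set: borel X]) u z.

Let intg u : continuous u ->
  m.-integrable [set: borel X] (EFin \o (u : borel X -> R)).
Proof. exact: Defs.continuous_compact_integrable. Qed.

Lemma rintD u v : continuous u -> continuous v ->
  rint (fun z => u z + v z) = rint u + rint v.
Proof. by move=> /intg iu /intg iv; exact: (RintegralD measurableT iu iv). Qed.

Lemma rintZ (c : R) u : continuous u -> rint (fun z => c * u z) = c * rint u.
Proof. by move=> /intg iu; exact: (RintegralZl c measurableT iu). Qed.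

Lemma rint_cst (c : R) : rint (fun=> c) = c.
Proof.
rewrite /rint (Rintegral_cst _ measurableT).
have -> : fine (m [set: borel X]) = 1 by rewrite (probability_setT m).
by rewrite mulr1.
Qed.

Lemma le_rint u v : continuous u -> continuous v -> (forall z, u z <= v z) ->
  rint u <= rint v.
Proof.
move=> /intg iu /intg iv uv.
by apply: (le_Rintegral measurableT iu iv) => z _; exact: uv.
Qed.

Lemma le_normr_rint u v : continuous u -> continuous v ->
  (forall z, `|u z| <= v z) -> `|rint u| <= rint v.
Proof.
move=> cu cv uv; apply: (le_trans (le_normr_Rintegral measurableT (intg cu))).
apply: le_rint => // z.
by apply: (continuous_comp (cu z)); exact: norm_continuous.
Qed.

(** Split into real and imaginary parts exactly as in [kernel_mul_fun], so that [kernel_mulE] holds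
    by computation. *)
Definition cint h : R[i]^o :=
  rint (fun z => Re (h z)) +i* rint (fun z => Im (h z)).

Lemma cintD h g : continuous h -> continuous g ->
  cint (fun z => h z + g z) = cint h + cint g.
Proof.
move=> ch cg; have [? ? ? ?] := And4 (continuous_Re ch) (continuous_Re cg)
  (continuous_Im ch) (continuous_Im cg).
rewrite /cint; apply/eqP; rewrite eq_complex/= -!rintD//.
by apply/andP; split; apply/eqP; congr rint; apply/funext => z; rewrite raddfD.
Qed.

Lemma cintZ (a : R[i]) h : continuous h -> cint (fun z => a * h z) = a * cint h.
Proof.
move=> ch; have [cRe cIm] := (continuous_Re ch, continuous_Im ch).
have cZ (c : R) u : continuous u -> continuous (fun z => c * u z).
  by move=> cu z; apply: cvgM; [exact: cvg_cst|exact: cu].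
case: a => a b; apply/eqP; rewrite eq_complex /cint/=; apply/andP; split.
  rewrite -mulNr -!rintZ// -rintD; try exact: cZ.
  apply/eqP; congr rint; apply/funext => z; rewrite mulNr.
  by case: (h z).
rewrite -!rintZ// -rintD; try exact: cZ.
by apply/eqP; congr rint; apply/funext => z; case: (h z).
Qed.

Lemma cint_cst (a : R[i]) : cint (fun=> a) = a.
Proof. by rewrite /cint !rint_cst; case: a. Qed.

Lemma cint_real u : cint (fun z => (u z)%:C) = (rint u)%:C.
Proof. by rewrite /cint/= rint_cst. Qed.

(* The factor 2 comes from bounding real and imaginary parts separately. *)
Lemma le_rnorm_cint h u : continuous h -> continuous u ->
  (forall z, Re `|h z| <= u z) -> Re `|cint h| <= 2 * rint u.
Proof.
move=> ch cu hu; rewrite (le_trans (Re_norm_le _))//= mulr_natl mulr2n lerD//.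
  apply: le_normr_rint => //; first exact: continuous_Re.
  by move=> z; exact: le_trans (normRe_le _) (hu z).
apply: le_normr_rint => //; first exact: continuous_Im.
by move=> z; exact: le_trans (normIm_le _) (hu z).
Qed.

End complex_integral.

(** * Kernel products, rank-one kernels and finite-rank representations *)

Section kernel_theory.
Context {R : realType} {X : ptopologicalType}.
Variables (cX : compact [set: X]) (m : probability (borel X) R).
Local Notation M := (kernel_algebra cX m).
Implicit Types (f g h : M) (p : X * X) (x y z : X).

Lemma kernelDE f g p : (f + g) p = f p + g p. Proof. by []. Qed.
Lemma kernelNE f p : (- f) p = - f p. Proof. by []. Qed.
Lemma kernelZE (a : R[i]) f p : (a *: f) p = a * f p. Proof. by []. Qed.

Lemma kernel_sumE (I : Type) (r : seq I) (F : I -> M) p :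
  (\sum_(i <- r) F i) p = \sum_(i <- r) F i p.
Proof. by elim/big_rec2 : _ => // i a b _ <-. Qed.

Lemma kernelP f g : (forall x y, f (x, y) = g (x, y)) -> f = g.
Proof. by move=> fg; apply/val_inj/funext => -[x y]; exact: fg. Qed.

Lemma rnorm_kernel_ge f p : Re `|f p| <= rnorm f.
Proof. exact: kernel_norm_ge. Qed.

Lemma rnorm_kernel_le f (c : R) :
  (forall x y, Re `|f (x, y)| <= c) -> rnorm f <= c.
Proof.
move=> fc; rewrite -rnorm_le; apply: kernel_norm_le => -[x y]; exact: fc.
Qed.

Lemma kernel_continuous_left f x : continuous (fun z => f (x, z)).
Proof.
move=> z; apply: (@continuous_comp _ _ _ (fun z => (x, z)) f).
  by apply: cvg_pair; [exact: cvg_cst|exact: cvg_id].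
exact: kernel_continuous.
Qed.

Lemma kernel_continuous_right f y : continuous (fun z => f (z, y)).
Proof.
move=> z; apply: (@continuous_comp _ _ _ (fun z => (z, y)) f).
  by apply: cvg_pair; [exact: cvg_id|exact: cvg_cst].
exact: kernel_continuous.
Qed.

Lemma kernel_continuous_prod f g x y :
  continuous (fun z => f (x, z) * g (z, y) : R[i]^o).
Proof.
move=> z; apply: cvgM; first exact: kernel_continuous_left.
exact: kernel_continuous_right.
Qed.
Hint Resolve kernel_continuous_left kernel_continuous_right
  kernel_continuous_prod : core.

Lemma kernel_mulE f g x y :
  (f ** g) (x, y) = cint m (fun z => f (x, z) * g (z, y)).
Proof. by []. Qed.

Lemma kernel_mulDl f g h : (f + g) ** h = f ** h + g ** h.
Proof.
apply: kernelP => x y; rewrite kernelDE !kernel_mulE -cintD//.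
by congr cint; apply/funext => z; rewrite kernelDE mulrDl.
Qed.

Lemma kernel_mulDr f g h : h ** (f + g) = h ** f + h ** g.
Proof.
apply: kernelP => x y; rewrite kernelDE !kernel_mulE -cintD//.
by congr cint; apply/funext => z; rewrite kernelDE mulrDr.
Qed.

Lemma kernel_mulZl (a : R[i]) f g : (a *: f) ** g = a *: (f ** g).
Proof.
apply: kernelP => x y; rewrite kernelZE !kernel_mulE -cintZ//.
by congr cint; apply/funext => z; rewrite kernelZE mulrA.
Qed.

Lemma kernel_mulZr (a : R[i]) f g : f ** (a *: g) = a *: (f ** g).
Proof.
apply: kernelP => x y; rewrite kernelZE !kernel_mulE -cintZ//.
by congr cint; apply/funext => z; rewrite kernelZE mulrCA.
Qed.

Lemma kernel_mulNl f g : (- f) ** g = - (f ** g).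
Proof. by rewrite -scaleN1r kernel_mulZl scaleN1r. Qed.

Lemma kernel_mulNr f g : f ** (- g) = - (f ** g).
Proof. by rewrite -scaleN1r kernel_mulZr scaleN1r. Qed.

Lemma kernel_mul_suml (I : Type) (r : seq I) (F : I -> M) f :
  (\sum_(i <- r) F i) ** f = \sum_(i <- r) F i ** f.
Proof.
elim/big_rec2 : _ => [|i a b _ <-]; last by rewrite kernel_mulDl.
by rewrite -(scale0r 0) kernel_mulZl !scale0r.
Qed.

Lemma kernel_mul_sumr (I : Type) (r : seq I) (F : I -> M) f :
  f ** (\sum_(i <- r) F i) = \sum_(i <- r) f ** F i.
Proof.
elim/big_rec2 : _ => [|i a b _ <-]; last by rewrite kernel_mulDr.
by rewrite -(scale0r 0) kernel_mulZr !scale0r.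
Qed.

Lemma rnorm_kernel_mul f g : rnorm (f ** g) <= 2 * rnorm f * rnorm g.
Proof.
apply: rnorm_kernel_le => x y; rewrite kernel_mulE.
have := @le_rnorm_cint R X cX m _ (fun=> rnorm f * rnorm g)
  (@kernel_continuous_prod f g x y) (fun=> @cvg_cst _ _ _ _ _).
rewrite rint_cst mulrA; apply => z.
by rewrite Re_normM ler_pM ?Re_norm_ge0 ?rnorm_kernel_ge.
Qed.

(* Column and row kernels encode f (x) 1 and 1 (x) g for functions f, g on X. *)
Definition col_kernel f := forall x y y', f (x, y) = f (x, y').
Definition row_kernel f := forall x x' y, f (x, y) = f (x', y).

Lemma col_mul f g : col_kernel g -> col_kernel (f ** g).
Proof.
move=> cg x y y'; rewrite !kernel_mulE; congr cint.
by apply/funext => z; rewrite (cg z y y').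
Qed.

Lemma row_mul f g : row_kernel f -> row_kernel (f ** g).
Proof.
move=> rf x x' y; rewrite !kernel_mulE; congr cint.
by apply/funext => z; rewrite (rf x x' z).
Qed.

Lemma colN f : col_kernel f -> col_kernel (- f).
Proof. by move=> cf x y y'; rewrite !kernelNE (cf x y y'). Qed.

(** The integrand does not depend on the integration variable, and [m] has mass 1. The points [x']
    and [y'] fill the ignored variables. *)
Lemma col_rowE f g x y x' y' : col_kernel f -> row_kernel g ->
  (f ** g) (x, y) = f (x, y') * g (x', y).
Proof.
move=> cf rg; rewrite kernel_mulE -[RHS](cint_cst m); congr cint.
by apply/funext => z; rewrite (cf x z y') (rg z x' y).
Qed.

(** When two adjacent factors form a rank-one kernel, associativity only pulls a scalar out of an
    integral; no integrals are interchanged. *)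
Lemma col_row_mulA f g h : col_kernel f -> row_kernel g ->
  f ** g ** h = f ** (g ** h).
Proof.
move=> cf rg; apply: kernelP => x y.
rewrite (col_rowE x y point point cf (row_mul _ rg)) !kernel_mulE -cintZ//.
congr cint; apply/funext => z.
by rewrite (col_rowE x z point point cf rg) mulrA.
Qed.

Lemma mul_col_rowA f g h : col_kernel g -> row_kernel h ->
  f ** g ** h = f ** (g ** h).
Proof.
move=> cg rh; apply: kernelP => x y.
rewrite (col_rowE x y point point (col_mul _ cg) rh) !kernel_mulE.
rewrite mulrC -cintZ//.
congr cint; apply/funext => z.
by rewrite (col_rowE z y point point cg rh) [LHS]mulrC mulrA.
Qed.

Definition tensor (t : seq (M * M)) : M := \sum_(s <- t) s.1 ** s.2.

Definition col_row (t : seq (M * M)) :=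
  forall s, s \in t -> col_kernel s.1 /\ row_kernel s.2.

Lemma tensorE t x y x' y' : col_row t ->
  tensor t (x, y) = \sum_(s <- t) s.1 (x, y') * s.2 (x', y).
Proof.
move=> ct; rewrite kernel_sumE; apply: eq_big_seq => s /ct[c r].
exact: col_rowE.
Qed.

Lemma mul_tensor f t : col_row t ->
  f ** tensor t = tensor [seq (f ** s.1, s.2) | s <- t].
Proof.
move=> ct; rewrite kernel_mul_sumr /tensor big_map.
by apply: eq_big_seq => s /ct[c r]; rewrite mul_col_rowA.
Qed.

Lemma tensor_mul f t : col_row t ->
  tensor t ** f = tensor [seq (s.1, s.2 ** f) | s <- t].
Proof.
move=> ct; rewrite kernel_mul_suml /tensor big_map.
by apply: eq_big_seq => s /ct[c r]; rewrite col_row_mulA.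
Qed.

Definition trace f : R[i]^o := cint m (fun z => f (z, z)).

End kernel_theory.

(** * Multiplier norms and the triple-product bound *)

Section bimodule_bounds.
Context {R : realType} {X : ptopologicalType}.
Variables (cX : compact [set: X]) (m : probability (borel X) R).
Local Notation M := (kernel_algebra cX m).
Implicit Types (f g k : M) (t p : seq (M * M)).

Let diagonal_continuous f : continuous (fun z => f (z, z)).
Proof.
move=> z; apply: (@continuous_comp _ _ _ (fun z => (z, z)) f).
  by apply: cvg_pair; exact: cvg_id.
exact: kernel_continuous.
Qed.

Lemma traceD f g : trace (f + g) = trace f + trace g.
Proof.
exact: (cintD cX m (@diagonal_continuous f) (@diagonal_continuous g)).
Qed.

Lemma trace_sum (I : Type) (r : seq I) (F : I -> M) :
  trace (\sum_(i <- r) F i) = \sum_(i <- r) trace (F i).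
Proof.
elim/big_rec2 : _ => [|i a b _ <-]; first by rewrite /trace (cint_cst m 0).
exact: traceD.
Qed.

Lemma trace_le f : Re `|trace f| <= 2 * rnorm f.
Proof.
have cc : continuous (fun _ : X => rnorm f) by move=> z; exact: cvg_cst.
rewrite -[X in _ <= 2 * X](rint_cst m).
apply: (le_rnorm_cint cX m (@diagonal_continuous f) cc) => z.
exact: rnorm_kernel_ge.
Qed.

(** Both sides carry the scalar integral of [c] times [b]. Read from right to left, it splits a
    rank-one kernel with a trace in front into two factors with exchanged halves, the source of the
    formula for tr(u) u. *)
Lemma mul_four a b c d :
  col_kernel a -> row_kernel b -> col_kernel c -> row_kernel d ->
  a ** b ** (c ** d : M) = trace (c ** b) *: (a ** d).
Proof.
move=> ca rb cc rd; apply: kernelP => x y; rewrite kernelZE.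
rewrite (col_rowE x y point point ca rd) [RHS]mulrC /trace kernel_mulE.
rewrite -(cintZ cX m); last exact: diagonal_continuous.
congr cint; apply/funext => z.
rewrite (col_rowE x z point point ca rb) (col_rowE z y point point cc rd).
by rewrite (col_rowE z z point point cc rb); ring.
Qed.

(** The multiplier norm of the overview, as a bound on both multiplication operators. It can stay
    bounded along an approximate unit whose supremum norms blow up. *)
Definition multiplier_bound k (K : R) := forall f,
  rnorm (k ** f) <= K * rnorm f /\ rnorm (f ** k) <= K * rnorm f.

(* In variables, this is [phi] applied to (x, y) |-> u(s, y) u(x, t), as a kernel
   in (s, t), for u = tensor p. *)
Definition contraction_kernel p (phi : M -> R[i]) : M :=
  \sum_(l <- p) \sum_(j <- p) phi (l.1 ** j.2) *: (j.1 ** l.2).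

(** At a fixed (x, y), the product with [f] is [phi] of a kernel in (x', y') that factors into a
    value of u = [tensor p] and a value of u ** f or f ** u. The first factor costs the norm of u,
    the second [K] times that of [f]. *)
Lemma contraction_kernel_bound p (phi : {linear M -> R[i]^o}) (K : R) :
  col_row p -> dual_ball phi -> multiplier_bound (tensor p) K ->
  multiplier_bound (contraction_kernel p phi) (rnorm (tensor p) * K).
Proof.
move=> cp phi1 pK f; have {phi1}phi1 v : Re `|phi v| <= rnorm v.
  by rewrite -lecR -Re_normE -rnormE; exact: phi1.
have [Kl Kr] := pK f.
have phiZ (a : R[i]) v : phi (a *: v) = a * phi v by rewrite linearZ.
have phi_sum (r : seq (M * M)) (F : M * M -> M) :
  phi (\sum_(i <- r) F i) = \sum_(i <- r) phi (F i) by rewrite linear_sum.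
have bound (z w : R[i]) (c : R) : Re `|w| <= c ->
    Re `|z| <= rnorm (tensor p) -> Re `|z * w| <= rnorm (tensor p) * c.
  by move=> wc zp; rewrite Re_normM ler_pM ?Re_norm_ge0.
split; apply: rnorm_kernel_le => x y.
  (* Linearity moves [phi] outside the double sum; [point] fills the variables that column and row
     kernels ignore. *)
  have -> : (contraction_kernel p phi ** f) (x, y) =
      phi (\sum_(l <- p) \sum_(j <- p)
        (j.1 (x, point) * (l.2 ** f) (point, y)) *: (l.1 ** j.2)).
    rewrite /contraction_kernel kernel_mul_suml kernel_sumE phi_sum.
    apply: eq_big_seq => l /cp[cl rl].
    rewrite kernel_mul_suml kernel_sumE phi_sum.
    apply: eq_big_seq => j /cp[cj rj].
    rewrite phiZ kernel_mulZl kernelZE col_row_mulA//.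
    by rewrite (col_rowE x y point point cj (row_mul _ rl)) mulrC.
  rewrite (le_trans (phi1 _))//; apply: rnorm_kernel_le => x' y'.
  have -> : (\sum_(l <- p) \sum_(j <- p)
      (j.1 (x, point) * (l.2 ** f) (point, y)) *: (l.1 ** j.2)) (x', y') =
      tensor p (x, y') * (tensor p ** f) (x', y).
    rewrite (tensorE x y' point point cp) tensor_mul// [in RHS]kernel_sumE.
    rewrite [LHS]kernel_sumE big_map mulr_sumr.
    apply: eq_big_seq => l /cp[cl rl].
    rewrite kernel_sumE mulr_suml; apply: eq_big_seq => j /cp[cj rj].
    rewrite kernelZE (col_rowE x' y' point point cl rj).
    by rewrite (col_rowE x' y point point cl (row_mul _ rl)); ring.
  rewrite -mulrA; apply: bound; last exact: rnorm_kernel_ge.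
  exact: le_trans (rnorm_kernel_ge _ _) Kl.
have -> : (f ** contraction_kernel p phi) (x, y) =
    phi (\sum_(l <- p) \sum_(j <- p)
      ((f ** j.1) (x, point) * l.2 (point, y)) *: (l.1 ** j.2)).
  rewrite /contraction_kernel kernel_mul_sumr kernel_sumE phi_sum.
  apply: eq_big_seq => l /cp[cl rl].
  rewrite kernel_mul_sumr kernel_sumE phi_sum.
  apply: eq_big_seq => j /cp[cj rj].
  rewrite phiZ kernel_mulZr kernelZE -mul_col_rowA//.
  by rewrite (col_rowE x y point point (col_mul _ cj) rl) mulrC.
rewrite (le_trans (phi1 _))//; apply: rnorm_kernel_le => x' y'.
have -> : (\sum_(l <- p) \sum_(j <- p)
    ((f ** j.1) (x, point) * l.2 (point, y)) *: (l.1 ** j.2)) (x', y') =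
    tensor p (x', y) * (f ** tensor p) (x, y').
  rewrite (tensorE x' y point point cp) mul_tensor// [in RHS]kernel_sumE.
  rewrite [LHS]kernel_sumE big_map mulr_suml.
  apply: eq_big_seq => l /cp[cl rl].
  rewrite kernel_sumE mulr_sumr; apply: eq_big_seq => j /cp[cj rj].
  rewrite kernelZE (col_rowE x' y' point point cl rj).
  by rewrite (col_rowE x y' point point (col_mul _ cj) rj); ring.
rewrite -mulrA; apply: bound; last exact: rnorm_kernel_ge.
exact: le_trans (rnorm_kernel_ge _ _) Kr.
Qed.

(** Evaluated at (x, y), the slice is [psi] of a kernel whose values are those of [tensor t] on the
    row of [x]. *)
Lemma slice_bound t (psi : {linear M -> R[i]^o}) :
  col_row t -> dual_ball psi ->
  rnorm (\sum_(s <- t) psi s.2 *: s.1) <= rnorm (tensor t).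
Proof.
move=> ct psi1; apply: rnorm_kernel_le => x y.
have -> : (\sum_(s <- t) psi s.2 *: s.1) (x, y) =
    psi (\sum_(s <- t) s.1 (x, y) *: s.2).
  rewrite kernel_sumE linear_sum; apply: eq_bigr => s _.
  by rewrite kernelZE linearZ mulrC.
apply: (@le_trans _ _ (rnorm (\sum_(s <- t) s.1 (x, y) *: s.2))).
  by rewrite -lecR -Re_normE -rnormE; exact: psi1.
apply: rnorm_kernel_le => x' y'.
have -> : (\sum_(s <- t) s.1 (x, y) *: s.2) (x', y') = tensor t (x, y').
  by rewrite kernel_sumE (tensorE x y' x' y ct).
exact: rnorm_kernel_ge.
Qed.

Variables (E : completeNormedModType R[i]).
Variable B : banach_bimodule (@kernel_mul R X cX m) E.

Hypothesis unit_cvg : forall u : nat -> M,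
  approximate_unit_seq (@kernel_mul R X cX m) u ->
  forall w : E, lact B (u n) w @[n --> \oo] --> w.

(** Uniform boundedness over all kernels of multiplier bound 1. Pointwise boundedness holds because
    an unbounded orbit of some [w] would allow a perturbation of [u] that is still an approximate
    unit but fails to converge on [w]. *)
Lemma lact_multiplier_bound (u : nat -> M) :
  approximate_unit_seq (@kernel_mul R X cX m) u ->
  exists2 C, 0 < C & forall k K, 0 < K -> multiplier_bound k K ->
    forall w, rnorm (lact B k w) <= C * K * rnorm w.
Proof.
move=> uu.
have [|i||C C0 kC] := @uniform_boundedness R {k : M | multiplier_bound k 1} E E
    (fun i => lact B (sval i)).
- by move=> i a v w; rewrite linearPr.
- have [c cB] := lact_bounded B; exists (c * rnorm (sval i)) => w.
  by have := cB (sval i) w; rewrite !rnormE -!rmorphM/= lecR.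
- move=> w; apply: contrapT => nb.
  have big n : exists k : M, multiplier_bound k 1 /\
      n.+1%:R <= rnorm (lact B k w).
    apply: contrapT => h; apply: nb; exists n.+1%:R => -[k k1] /=.
    by rewrite leNgt; apply/negP => lt; apply: h; exists k; rewrite ltW.
  have [k kP] := choice big.
  (* The added term tends to 0 as a multiplier, yet moves [w] by at least 1 at every index. *)
  pose v n := u n + (n.+1%:R^-1 : R)%:C *: k n.
  have small (c e : R) : 0 <= c -> 0 < e ->
      exists N, forall n, (N <= n)%N -> n.+1%:R^-1 * c <= e.
    move=> c0 e0; exists (Num.truncn (c / e)) => n cn.
    rewrite ler_pdivrMl// mulrC -ler_pdivrMl// mulrC ltW//.
    by rewrite (lt_le_trans (truncnS_gt _))// ler_nat ltnS.
  have ReV n : Re `|(n.+1%:R^-1 : R)%:C : R[i]| = n.+1%:R^-1.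
    by rewrite ger0_norm ?ler0c ?invr_ge0.
  have vv : approximate_unit_seq (@kernel_mul R X cX m) v.
    move=> a; have [ua au] := uu a; split; apply/cvg_rnormP => e e0.
      have [|N uN] := (cvg_rnormP _ _).1 ua (e / 2); first by rewrite divr_gt0.
      have [|N' sN'] := small (rnorm a) (e / 2) (rnorm_ge0 _).
        by rewrite divr_gt0.
      exists (maxn N N') => n; rewrite geq_max => /andP[/uN Nn /sN' N'n].
      rewrite /v kernel_mulDr kernel_mulZr addrAC [leRHS]splitr.
      rewrite (le_trans (rnormD _ _))// lerD// rnormZ ReV.
      rewrite (le_trans _ N'n)// ler_wpM2l//.
      by have [/(_ a)[_]] := kP n; rewrite mul1r.
    have [|N uN] := (cvg_rnormP _ _).1 au (e / 2); first by rewrite divr_gt0.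
    have [|N' sN'] := small (rnorm a) (e / 2) (rnorm_ge0 _).
      by rewrite divr_gt0.
    exists (maxn N N') => n; rewrite geq_max => /andP[/uN Nn /sN' N'n].
    rewrite /v kernel_mulDl kernel_mulZl addrAC [leRHS]splitr.
    rewrite (le_trans (rnormD _ _))// lerD// rnormZ ReV.
    rewrite (le_trans _ N'n)// ler_wpM2l//.
    by have [/(_ a)[]] := kP n; rewrite mul1r.
  (* Errors of 1/4 for [u] and for [v] would leave at most 1/2 for the added term, whose norm is at
     least 1. *)
  have q0 : 0 < 4^-1 :> R by rewrite invr_gt0.
  have /cvg_rnormP/(_ _ q0)[N uN] := @unit_cvg u uu w.
  have /cvg_rnormP/(_ _ q0)[N' vN] := @unit_cvg v vv w.
  have /uN := leq_maxl N N'; have /vN := leq_maxr N N'.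
  set n := maxn N N'; rewrite /v linearDl linearZl_LR/=.
  set a := lact B (u n) w; set b := _ *: _ => h1 h2.
  have : 1 <= rnorm b.
    rewrite rnormZ ReV -ler_pdivrMl ?invr_gt0// invrK mulr1.
    by have [] := kP n.
  have -> : b = (a + b - w) - (a - w).
    by rewrite opprB addrA subrK addrAC subrr add0r.
  have := rnormB (a + b - w) (a - w); lra.
exists C => // k K K0 kK w.
have k1 : multiplier_bound ((K^-1)%:C *: k) 1.
  have ReK : Re `|(K^-1)%:C : R[i]| = K^-1.
    by rewrite ger0_norm ?ler0c ?invr_ge0 ?ltW.
  move=> f; have [h1 h2] := kK f.
  by rewrite kernel_mulZl kernel_mulZr !rnormZ ReK !ler_pdivrMl// mul1r.
have := kC (exist (fun i : M => multiplier_bound i 1) _ k1) w.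
rewrite /= linearZl_LR/= rnormZ.
rewrite ger0_norm ?ler0c ?invr_ge0 ?(ltW K0)//= ler_pdivrMl//.
by rewrite mulrA (mulrC K).
Qed.

End bimodule_bounds.

(** The supremum is meaningful only for a nonempty set that is bounded above: the zero functionals
    give an element, and [c] is the bound. *)
Lemma injective_norm_bound (R : realType) (U V W : normedModType R[i])
    (t : seq (U * V * W)) (c : R) :
  (forall (phi : {linear U -> R[i]^o}) (xi : {linear V -> R[i]^o})
      (psi : {linear W -> R[i]^o}),
    dual_ball phi -> dual_ball xi -> dual_ball psi ->
    Re `|\sum_(s <- t) phi s.1.1 * xi s.1.2 * psi s.2 : R[i]| <= c) ->
  0 <= injective_norm t <= c.
Proof.
move=> tc; have ball0 (V' : normedModType R[i]) :
    dual_ball (\0 : {linear V' -> R[i]^o}) by move=> v /=; rewrite normr0.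
rewrite /injective_norm; set A := (X in sup X).
have Ac : ubound A c.
  by move=> _ [phi [xi [psi [phi1 xi1 psi1 ->]]]]; exact: tc.
pose r0 := Re `|\sum_(s <- t) (\0 : {linear U -> R[i]^o}) s.1.1 *
  (\0 : {linear V -> R[i]^o}) s.1.2 * (\0 : {linear W -> R[i]^o}) s.2 : R[i]|.
have Ar0 : A r0 by exists \0, \0, \0.
rewrite ge_sup ?andbT//; last by exists r0.
by rewrite (le_trans _ (ub_le_sup _ Ar0)) ?Re_norm_ge0//; exists c.
Qed.

(** * The bound of Upsilon by the supremum norm *)

Section upsilon_bound.
Context {R : realType} {X : ptopologicalType}.
Variables (cX : compact [set: X]) (m : probability (borel X) R).
Local Notation M := (kernel_algebra cX m).
Implicit Types (f g k : M) (t p : seq (M * M)).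
Variables (E : completeNormedModType R[i]).
Variable B : banach_bimodule (@kernel_mul R X cX m) E.

(** By [mul_four], each term of tr(u) u splits in two: the first factor stays outside on the left
    and the second is absorbed into the module element, leaving triple products for the
    injective-norm hypothesis. *)
Lemma trace_lact_tensor p (I : Type) (r : seq I) (w : I -> E) (b : I -> M) :
  col_row p ->
  trace (tensor p) *: lact B (tensor p) (\sum_(i <- r) ract B (w i) (b i)) =
  \sum_(l <- p) \sum_(j <- p) \sum_(i <- r)
    ract B (lact B (l.1 ** j.2) (lact B (j.1 ** l.2) (w i))) (b i).
Proof.
move=> cp; rewrite [in X in lact B X]/tensor linear_sumlz scaler_sumr.
apply: eq_big_seq => l /cp[cl rl].
rewrite {1}/tensor trace_sum scaler_suml; apply: eq_big_seq => j /cp[cj rj].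
rewrite -linearZl_LR -mul_four// linear_sumr; apply: eq_bigr => i _.
by rewrite -lractA lactA.
Qed.

Hypothesis injective_cont :
  injectively_continuous (fun a w b => ract B (lact B a w) b).

Hypothesis unit_cvg : forall u : nat -> M,
  approximate_unit_seq (@kernel_mul R X cX m) u ->
  forall w : E, lact B (u n) w @[n --> \oo] --> w.

Variables (D : {linear M -> E}) (p : nat -> seq (M * M)) (K : R).
Hypothesis D_bounded : bounded_operator D.
Hypothesis p_col_row : forall n, col_row (p n).
Hypothesis p_unit :
  approximate_unit_seq (@kernel_mul R X cX m) (fun n => tensor (p n)).
Hypothesis p_bound : forall n, multiplier_bound (tensor (p n)) K.
Hypothesis p_trace : forall n,
  0 < rnorm (tensor (p n)) <= K * Re `|trace (tensor (p n))|.

(** The image of the sum under the action of each [tensor (p n)] is bounded independently of [n];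
    the approximate unit then carries the bound to the sum itself. *)
Lemma upsilon_bound : exists C : R, forall t, col_row t ->
  rnorm (\sum_(s <- t) ract B (D s.1) s.2) <= C * rnorm (tensor t).
Proof.
have [c cP] := injective_cont.
have [C C0 CP] := lact_multiplier_bound unit_cvg p_unit.
have [d dP] := D_bounded.
have {}dP a : rnorm (D a) <= Num.max 0 d * rnorm a.
  have := dP a; rewrite !rnormE -rmorphM lecR => /le_trans; apply.
  by rewrite ler_wpM2r ?rnorm_ge0// le_max lexx orbT.
have d0 : 0 <= Num.max 0 d by rewrite le_max lexx.
move: (Num.max 0 d) d0 dP => {}d d0 dP.
have K0 : 0 < K.
  have /andP[u0 /(lt_le_trans u0) Ktr] := p_trace 0.
  rewrite ltNge; apply/negP => K0; move: Ktr; apply/negP; rewrite -leNgt.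
  by rewrite mulr_le0_ge0// Re_norm_ge0.
exists (`|c| * (C * (K * K) * d)) => t ct.
set y := \sum_(s <- t) _.
have step n : rnorm (lact B (tensor (p n)) y) <=
    `|c| * (C * (K * K) * d) * rnorm (tensor t).
  have /andP[u0 utr] := p_trace n; set u := tensor (p n) in u0 utr *.
  have tr0 : 0 < Re `|trace u| by rewrite -(pmulr_rgt0 _ K0) (lt_le_trans u0).
  (* The triples that represent tr(u) u Upsilon(t), over all pairs (l, j) from [p n] and all [s]
     from [t]. *)
  pose T := [seq (q.1.1 ** q.2.2, lact B (q.2.1 ** q.1.2) (D s.1), s.2) |
    q <- [seq (l, j) | l <- p n, j <- p n], s <- t].
  have TE : trace u *: lact B u y =
      \sum_(s <- T) ract B (lact B s.1.1 s.1.2) s.2.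
    by rewrite trace_lact_tensor// /T !big_allpairs_dep.
  have uK0 : 0 < rnorm u * K by rewrite mulr_gt0.
  have /andP[T0 TK] : 0 <= injective_norm T <=
      C * (rnorm u * K) * (d * rnorm (tensor t)).
    apply: injective_norm_bound => phi xi psi phi1 xi1 psi1.
    pose a := \sum_(s <- t) psi s.2 *: s.1.
    have lactZl (z : R[i]) k w : lact B (z *: k) w = z *: lact B k w.
      exact: linearZl_LR.
    have lactZr (z : R[i]) k w : lact B k (z *: w) = z *: lact B k w.
      exact: linearZr.
    have DZ (z : R[i]) k : D (z *: k) = z *: D k by exact: linearZ.
    have xiZ (z : R[i]) w : xi (z *: w) = z * xi w by exact: linearZ.
    have lact_suml (r : seq (M * M)) (F : M * M -> M) w :
        lact B (\sum_(i <- r) F i) w = \sum_(i <- r) lact B (F i) w.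
      exact: linear_sumlz.
    have lact_sumr (r : seq (M * M)) k (F : M * M -> E) :
        lact B k (\sum_(i <- r) F i) = \sum_(i <- r) lact B k (F i).
      exact: linear_sumr.
    have D_sum (r : seq (M * M)) (F : M * M -> M) :
        D (\sum_(i <- r) F i) = \sum_(i <- r) D (F i).
      exact: linear_sum.
    have xi_sum (r : seq (M * M)) (F : M * M -> E) :
        xi (\sum_(i <- r) F i) = \sum_(i <- r) xi (F i).
      exact: linear_sum.
    (* Summing [phi] over (l, j) gives the contraction kernel, and summing [psi] over [s] gives the
       slice [a]; only one action on [D a] is left to estimate. *)
    have -> : \sum_(s <- T) phi s.1.1 * xi s.1.2 * psi s.2 =
        xi (lact B (contraction_kernel (p n) phi) (D a)).
      rewrite /T !big_allpairs_dep /contraction_kernel lact_suml xi_sum.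
      apply: eq_bigr => l _; rewrite lact_suml xi_sum.
      apply: eq_bigr => j _; rewrite /a D_sum lact_sumr xi_sum.
      apply: eq_bigr => s _.
      by rewrite lactZl DZ lactZr !xiZ (mulrC (psi _)) mulrA.
    set w := lact B _ _; apply: (@le_trans _ _ (rnorm w)).
      by rewrite -lecR -Re_normE -rnormE; exact: xi1.
    rewrite (le_trans (CP _ _ uK0 (contraction_kernel_bound _ phi1 _) _))//.
    rewrite ler_wpM2l//; first by rewrite mulr_ge0// ltW.
    rewrite (le_trans (dP _))// ler_wpM2l//.
    exact: slice_bound.
  have := cP T; rewrite -TE rnorm_le rnormZ => /le_trans.
  move=> /(_ (`|c| * (C * (rnorm u * K) * (d * rnorm (tensor t))))).
  have cT : c * injective_norm T <= `|c| * injective_norm T.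
    by rewrite ler_wpM2r// ler_norm.
  move=> /(_ (le_trans cT (ler_wpM2l (normr_ge0 c) TK))) h.
  (* Here [p_trace] trades the norm of [u] for [K] times its trace, which cancels against the trace
     on the left; hence the second [K] in the constant. *)
  rewrite -(ler_pM2l tr0) (le_trans h)//.
  rewrite [leLHS](_ : _ = rnorm u * (`|c| * (C * K * d) * rnorm (tensor t)));
    last by ring.
  rewrite [leRHS](_ : _ = K * Re `|trace u| *
    (`|c| * (C * K * d) * rnorm (tensor t))); last by ring.
  by rewrite ler_wpM2r// !mulr_ge0 ?rnorm_ge0// ltW.
apply/ler_addgt0Pr => e e0.
have /cvg_rnormP/(_ _ e0)[N /(_ N (leqnn N))] := @unit_cvg _ p_unit y.
have := step N; set uy := lact B _ y; have := rnormB uy (uy - y).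
by rewrite subKr; lra.
Qed.

End upsilon_bound.

(** * The approximating sequence *)

Section approximately_inner.
Context {R : realType} {X : ptopologicalType}.
Variables (cX : compact [set: X]) (m : probability (borel X) R).
Local Notation M := (kernel_algebra cX m).
Implicit Types (f g k : M) (t p : seq (M * M)).
Variables (E : completeNormedModType R[i]).
Variable B : banach_bimodule (@kernel_mul R X cX m) E.
Variables (D : {linear M -> E}).
Hypothesis D_derivation : derivation B D.

(** This is both the map [Lambda] and, at [t = p n], the implementing element of index [n]. *)
Definition lambda_sum t := \sum_(s <- t) lact B s.1 (D s.2).

(** An explicit representation of the commutator of [f] with [tensor t], so that a bound on [Lambda]
    over column-row lists applies to it. *)
Definition commutator_tensor f t :=
  [seq (f ** s.1, s.2) | s <- t] ++ [seq (- s.1, s.2 ** f) | s <- t].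

Lemma commutator_tensor_col_row f t : col_row t ->
  col_row (commutator_tensor f t).
Proof.
move=> ct s; rewrite mem_cat => /orP[] /mapP[r /ct[cr rr] ->] /=; split => //.
- exact: col_mul.
- exact: colN.
- exact: row_mul.
Qed.

Lemma commutator_tensorE f t : col_row t ->
  tensor (commutator_tensor f t) = f ** tensor t - tensor t ** f.
Proof.
move=> ct; rewrite mul_tensor// tensor_mul// /tensor big_cat; congr (_ + _).
rewrite !big_map -sumrN; apply: eq_bigr => s _; exact: kernel_mulNl.
Qed.

(** By the Leibniz rule, D(s.2 ** f) yields the term of the right commutator and a term s.2 D(f);
    the latter sum up to what the action of [tensor t] on [D f] cancels. *)
Lemma lambda_sum_commutator f t :
  lact B f (lambda_sum t) - ract B (lambda_sum t) f =
  lambda_sum (commutator_tensor f t) + lact B (tensor t) (D f).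
Proof.
rewrite /lambda_sum big_cat !big_map linear_sumr linear_sumlz -addrA.
congr (_ + _); first by apply: eq_bigr => s _; rewrite lactA.
rewrite /tensor linear_sumlz -sumrN -big_split; apply: eq_bigr => s _ /=.
have -> : lact B (s.1 ** s.2) (D f) = lact B s.1 (lact B s.2 (D f)).
  exact: lactA.
have lactN k w : lact B (- k) w = - lact B k w by exact: linearNl.
by rewrite D_derivation lactN lractA linearDr opprD addrAC addNr add0r.
Qed.

Lemma derivation_tensor t :
  D (tensor t) = lambda_sum t + \sum_(s <- t) ract B (D s.1) s.2.
Proof.
rewrite /tensor linear_sum -big_split; apply: eq_bigr => s _.
exact: D_derivation.
Qed.

Hypothesis injective_cont :
  injectively_continuous (fun a w b => ract B (lact B a w) b).

Hypothesis unit_cvg : forall u : nat -> M,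
  approximate_unit_seq (@kernel_mul R X cX m) u ->
  forall w : E, lact B (u n) w @[n --> \oo] --> w.

Variables (p : nat -> seq (M * M)) (K : R).
Hypothesis D_bounded : bounded_operator D.
Hypothesis p_col_row : forall n, col_row (p n).
Hypothesis p_unit :
  approximate_unit_seq (@kernel_mul R X cX m) (fun n => tensor (p n)).
Hypothesis p_bound : forall n, multiplier_bound (tensor (p n)) K.
Hypothesis p_trace : forall n,
  0 < rnorm (tensor (p n)) <= K * Re `|trace (tensor (p n))|.

Lemma derivation_approximately_inner : sequentially_approximately_inner B D.
Proof.
have [C CP] := upsilon_bound injective_cont unit_cvg D_bounded p_col_row
  p_unit p_bound p_trace.
have [d dP] := D_bounded.
have {}dP a : rnorm (D a) <= d * rnorm a.
  by have := dP a; rewrite !rnormE -rmorphM lecR.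
(* [D (tensor t)] is Lambda plus Upsilon, so the bounds on [D] and on Upsilon add up to one on
   Lambda. *)
have LP t : col_row t ->
    rnorm (lambda_sum t) <= (`|C| + `|d|) * rnorm (tensor t).
  move=> ct; have := derivation_tensor t.
  move=> /(congr1 (fun w => w - \sum_(s <- t) ract B (D s.1) s.2)).
  rewrite addrK => <-; rewrite (le_trans (rnormB _ _))// addrC mulrDl lerD//.
    by rewrite (le_trans (CP _ ct))// ler_wpM2r ?rnorm_ge0// ler_norm.
  by rewrite (le_trans (dP _))// ler_wpM2r ?rnorm_ge0// ler_norm.
exists (fun n => lambda_sum (p n)) => a; apply/cvg_rnormP => e e0.
(* The added 1 makes the constant safe to divide by. Half of [e] goes to Lambda of the commutator,
   half to the convergence on [D a]. *)
have C0 : 0 < `|C| + `|d| + 1 by rewrite ltr_wpDl// addr_ge0.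
have [e' e'0 e'E] : exists2 e', 0 < e' & (`|C| + `|d| + 1) * (e' + e') = e / 2.
  exists (e / 4 / (`|C| + `|d| + 1)); first by rewrite !divr_gt0.
  by field; rewrite gt_eqF.
have [/cvg_rnormP/(_ _ e'0)[N1 N1P] /cvg_rnormP/(_ _ e'0)[N2 N2P]] := p_unit a.
have e20 : 0 < e / 2 by rewrite divr_gt0.
have /cvg_rnormP/(_ _ e20)[N3 N3P] := @unit_cvg _ p_unit (D a).
exists (maxn N1 (maxn N2 N3)) => n.
rewrite !geq_max => /and3P[/N1P h1 /N2P h2 /N3P h3].
rewrite lambda_sum_commutator -addrA (le_trans (rnormD _ _))// [leRHS]splitr.
have crn := @commutator_tensor_col_row a _ (@p_col_row n).
rewrite lerD// (le_trans (LP _ crn))//.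
rewrite commutator_tensorE//.
have h4 : rnorm (a ** tensor (p n) - tensor (p n) ** a) <= e' + e'.
  have -> : a ** tensor (p n) - tensor (p n) ** a =
      (a ** tensor (p n) - a) - (tensor (p n) ** a - a).
    by rewrite opprB addrA subrK.
  exact: le_trans (rnormB _ _) (lerD h1 h2).
rewrite -e'E; apply: ler_pM; rewrite ?rnorm_ge0 ?addr_ge0//.
by rewrite lerDl.
Qed.

End approximately_inner.

(** * Approximation by finite-rank kernels *)

Section compatible_metric_theory.
Context {R : realType} {X : ptopologicalType}.
Variable cX : compact [set: X].
Variables (d : X -> X -> R) (cd : compatible_metric d).
Implicit Types x y z : X.

Lemma dist_xx x : d x x = 0. Proof. by case: cd => d0 _ _ _; exact/d0. Qed.

Lemma dist_sym x y : d x y = d y x. Proof. by case: cd. Qed.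

Lemma dist_triangle x y z : d x z <= d x y + d y z. Proof. by case: cd. Qed.

Lemma near_dist x (e : R) : 0 < e -> \forall y \near x, d x y < e.
Proof. by case: cd => _ _ _ dn e0; apply/dn; exists e. Qed.

Lemma dist_continuous : continuous (fun p : X * X => d p.1 p.2).
Proof.
move=> [x y]; apply/cvgrPdist_le => /= e e0.
have e20 : 0 < e / 2 by rewrite divr_gt0.
near=> p.
have h1 : d x p.1 < e / 2.
  by near: p; exact: (cvg_fst (near_dist x e20)).
have h2 : d y p.2 < e / 2.
  by near: p; exact: (cvg_snd (near_dist y e20)).
have := dist_triangle x p.1 y; have := dist_triangle p.1 p.2 y.
have := dist_triangle p.1 x p.2; have := dist_triangle x y p.2.
by rewrite ler_norml (dist_sym p.2 y) (dist_sym p.1 x); lra.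
Unshelve. all: by end_near. Qed.

Lemma dist_continuous_right x : continuous (d x).
Proof.
move=> y; apply: (@continuous_comp _ _ _ (fun z => (x, z))
  (fun p : X * X => d p.1 p.2)); last exact: dist_continuous.
by apply: cvg_pair => /=; [exact: cvg_cst|exact: cvg_id].
Qed.

Lemma ball_open x (r : R) : open [set y | d x y < r].
Proof.
have -> : [set y | d x y < r] = d x @^-1` [set s | s < r] by [].
by apply: open_comp => [z _|]; [exact: dist_continuous_right|exact: open_lt].
Qed.

(** Compactness of the square, as a near-covering property along the radii 1/(n+1), turns local
    radii into a common one. *)
Lemma uniformly_continuous_left (f : X * X -> R[i]^o) (e : R) :
  continuous f -> 0 < e -> exists2 r, 0 < r &
    forall x x' y, d x x' < r -> Re `|f (x, y) - f (x', y)| <= e.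
Proof.
move=> cf e0; have cXX : compact [set: X * X].
  by rewrite -setXTT; exact: compact_setX.
have /compact_near_coveringP/(_ nat \oo (fun n p => forall x',
    d p.1 x' < n.+1%:R^-1 -> Re `|f p - f (x', p.2)| <= e)) := cXX.
case=> [[x y] _|n _ /(_ n (leqnn n)) nP]; last first.
  by exists n.+1%:R^-1; [rewrite invr_gt0|move=> x x' y; exact: (nP (x, y))].
have e20 : 0 < e / 2 by rewrite divr_gt0.
have [/= [U V] [Ux Vy] UV] :
    nbhs (x, y) [set p | Re `|f (x, y) - f p| <= e / 2].
  have e20' : 0 < ((e / 2)%:C : R[i]) by rewrite ltcR.
  have /cvgrPdist_le/(_ _ e20') := cf (x, y); apply: filterS => p /=.
  by rewrite Re_normE lecR.
have [r r0 rU] : exists2 r, 0 < r & [set z | d x z < r] `<=` U.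
  by case: cd => _ _ _ dn; exact/dn.
have r20 : 0 < r / 2 by rewrite divr_gt0.
(* Half of [r] for the base point and half for the increment keep both compared points within [r] of
   [x]. *)
exists ([set p | d x p.1 < r / 2 /\ V p.2],
        [set n | n.+1%:R^-1 <= r / 2]) => /=.
  split.
    near=> p; split.
      by near: p; exact: (cvg_fst (near_dist x r20)).
    by near: p; exact: (cvg_snd Vy).
  exists (Num.truncn (r / 2)^-1) => // n /= nr.
  rewrite invf_ple ?posrE// ltW// (lt_le_trans (truncnS_gt _))//.
  by rewrite ler_nat ltnS.
move=> [[x1 y1] n] /= [[xx1 Vy1] nr] x2 x12.
rewrite -(subrKA (f (x, y))) (le_trans (Re_normD _ _))// [leRHS]splitr lerD//.
  rewrite distrC; apply: (UV (x1, y1)); split=> //=; apply: rU => /=.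
  by rewrite (lt_trans xx1)// ltr_pdivrMr// ltr_pMr// ltr1n.
apply: (UV (x2, y1)); split=> //=; apply: rU => /=.
rewrite (le_lt_trans (dist_triangle x x1 x2))// [ltRHS]splitr ltrD//.
exact: lt_le_trans x12 nr.
Unshelve. all: by end_near. Qed.

Lemma uniformly_continuous_right (f : X * X -> R[i]^o) (e : R) :
  continuous f -> 0 < e -> exists2 r, 0 < r &
    forall x y y', d y y' < r -> Re `|f (x, y) - f (x, y')| <= e.
Proof.
move=> cf e0; pose g (p : X * X) := f (p.2, p.1).
have cg : continuous g.
  move=> p; apply: (@continuous_comp _ _ _ (fun q : X * X => (q.2, q.1)) f).
    by apply: cvg_pair; [exact: cvg_snd|exact: cvg_fst].
  exact: cf.
have [r r0 rP] := uniformly_continuous_left cg e0.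
by exists r => // x y y'; exact: rP.
Qed.

Lemma finite_net (r : R) : 0 < r -> exists s : seq X,
  forall x, exists2 c, c \in s & d c x < r.
Proof.
move=> r0; move: (cX); rewrite compact_cover.
move=> /(_ X [set: X] (fun c => [set x | d c x < r])).
case=> [c _|x _|D' _ D'P]; first exact: ball_open.
  by exists x => //=; rewrite dist_xx.
exists (finmap.enum_fset D') => x.
by have [//|c /= cD' cx] := D'P x; exists c.
Qed.

Variable m : probability (borel X) R.
Local Notation M := (kernel_algebra cX m).

Definition kernel_of (f : X * X -> R[i]^o) (cf : continuous f) : M :=
  Defs.Kernel cX m (asboolT cf).

(** A partition of unity [rho c / S] on a finite net replaces f(x, y) by a weighted mean of the
    values f(c, y) with [c] close to [x]. *)
Lemma finite_rank_dense (f : M) (e : R) : 0 < e ->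
  exists2 t : seq (M * M), col_row t & rnorm (f - tensor t) <= e.
Proof.
move=> e0.
have [r r0 rP] := uniformly_continuous_left (@kernel_continuous _ _ _ _ f) e0.
have [s sP] := finite_net r0.
pose rho c x : R := Num.max 0 (r - d c x).
have rho0 c x : 0 <= rho c x by rewrite le_max lexx.
have crho c : continuous (rho c).
  move=> x; apply: (@continuous_max _ _ (fun=> 0) (fun x => r - d c x)).
    exact: cvg_cst.
  by apply: cvgB; [exact: cvg_cst|exact: dist_continuous_right].
pose S x := \sum_(c <- s) rho c x.
have S0 x : 0 < S x.
  have [c cs cx] := sP x; rewrite /S (big_rem c)//=.
  by rewrite ltr_pwDl ?sumr_ge0// lt_max subr_gt0 cx orbT.
have cS : continuous S.
  move=> x; rewrite /S; apply: (@cvg_big _ _ +%R 0 xpredT) => //.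
    exact: add_continuous.
  by move=> c _; exact: crho.
pose P c (p : X * X) : R[i]^o := (rho c p.1 / S p.1) +i* 0.
have cP c : continuous (P c).
  apply: continuous_complex => [p|p]; last exact: cvg_cst.
  apply: (@continuous_comp _ _ _ fst (fun x => rho c x / S x)).
    exact: cvg_fst.
  by apply: cvgM; [exact: crho|apply: cvgV; [rewrite gt_eqF|exact: cS]].
pose F c (p : X * X) : R[i]^o := f (c, p.2).
have cF c : continuous (F c).
  move=> p; apply: (@continuous_comp _ _ _ snd (fun y => f (c, y))).
    exact: cvg_snd.
  exact: kernel_continuous_left.
pose t := [seq (kernel_of (cP c), kernel_of (cF c)) | c <- s].
have ct : col_row t by move=> _ /mapP[c _ ->]; split.
exists t => //; apply: rnorm_kernel_le => x y.
rewrite kernelDE kernelNE (tensorE x y x y ct) big_map.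
have -> : f (x, y) - \sum_(c <- s) P c (x, x) * F c (x, y) =
    \sum_(c <- s) P c (x, x) * (f (x, y) - f (c, y)).
  rewrite (eq_bigr _ (fun c _ => mulrBr _ _ _)) sumrB -mulr_suml.
  have -> : \sum_(c <- s) P c (x, x) = 1.
    rewrite -(rmorph_sum (real_complex R))/= -mulr_suml divff//.
    exact: lt0r_neq0 (S0 x).
  by rewrite mul1r.
(* With [e] written as the same weighted sum, the estimate is made term by term; terms with [c] far
   from [x] have weight 0. *)
have -> : e = \sum_(c <- s) rho c x / S x * e.
  by rewrite -mulr_suml -mulr_suml divff ?mul1r//; exact: lt0r_neq0 (S0 x).
elim/big_ind2 : _ => [|u u' v v' uu' vv'|c _].
- by rewrite normr0.
- by rewrite (le_trans (Re_normD _ _))// lerD.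
- rewrite Re_normM ger0_norm ?ler0c ?divr_ge0 ?(ltW (S0 _))//=.
  have [cxr|cxr] := ltP (d c x) r.
    rewrite ler_wpM2l ?divr_ge0 ?(ltW (S0 _))//.
    rewrite -[leLHS]/(Re `|f (x, y) - f (c, y)|) distrC; exact: rP.
  by rewrite /rho max_l ?subr_le0// !mul0r.
Qed.

End compatible_metric_theory.

Lemma Re_normC (R : realType) (r : R) : 0 <= r -> Re `|r%:C : R[i]| = r.
Proof. by move=> r0; rewrite ger0_norm ?ler0c. Qed.

(** * Integrals compared with masses of open sets, and weighted means *)

Section measure_comparison.
Context {R : realType} {X : ptopologicalType}.
Variables (cX : compact [set: X]) (m : probability (borel X) R).
Implicit Types (u : X -> R) (A : set X).

Let measurable_open A : open A -> measurable (A : set (borel X)).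
Proof. by move=> oA; exact: sub_sigma_algebra. Qed.

Let measurable_u u : continuous u ->
  measurable_fun [set: borel X] (EFin \o (u : borel X -> R)).
Proof.
by move=> cu; apply/measurable_EFinP; exact: continuous_borel_measurable.
Qed.

Let measurable_1 A : open A ->
  measurable_fun [set: borel X] (EFin \o (\1_A : borel X -> R)).
Proof.
move=> oA; apply/measurable_EFinP; apply: measurable_indic.
exact: measurable_open.
Qed.

Let rintE u : continuous u ->
  (rint m u)%:E = (\int[m]_(z in [set: borel X]) (u z)%:E)%E.
Proof.
move=> cu; rewrite fineK//.
have := Defs.continuous_compact_integrable cX m cu.
by move=> /(integrable_fin_num measurableT).
Qed.

Let measureE A : open A ->
  (fine (m A))%:E = (\int[m]_(z in [set: borel X]) (\1_A z)%:E)%E.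
Proof.
move=> oA; rewrite integral_indic//; last exact: measurable_open.
by rewrite setIT fineK// fin_num_measure//; exact: measurable_open.
Qed.

Lemma measure_le_rint A u : open A -> continuous u -> (forall z, 0 <= u z) ->
  (forall z, A z -> 1 <= u z) -> fine (m A) <= rint m u.
Proof.
move=> oA cu u0 Au; rewrite -lee_fin rintE// measureE//.
apply: (ge0_le_integral m measurableT).
- by move=> z _; rewrite lee_fin.
- exact: measurable_1.
- exact: measurable_u.
- move=> z _; rewrite lee_fin indicE.
  by have [/set_mem/Au|_] := boolP (z \in A); [|exact: u0].
Qed.

Lemma rint_le_measure A u : open A -> continuous u ->
  (forall z, 0 <= u z <= 1) -> (forall z, u z != 0 -> A z) ->
  rint m u <= fine (m A).
Proof.
move=> oA cu u01 uA; rewrite -lee_fin rintE// measureE//.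
apply: (ge0_le_integral m measurableT).
- by move=> z _; rewrite lee_fin; case/andP: (u01 z).
- exact: measurable_u.
- exact: measurable_1.
- move=> z _; rewrite lee_fin indicE.
  have [->|/uA/mem_set ->] := eqVneq (u z) 0; first by case: (z \in A).
  by case/andP: (u01 z).
Qed.

(** The error is the integral of k (h - a) plus [a] times the mass defect of [k]. The factor 2 is
    that of [le_rnorm_cint]. *)
Lemma weighted_mean (k : X -> R) (h : X -> R[i]^o) (a : R[i]) (e eta A : R) :
  continuous k -> continuous h -> (forall z, 0 <= k z) -> 0 <= e ->
  1 - eta <= rint m k <= 1 -> Re `|a| <= A ->
  (forall z, k z != 0 -> Re `|h z - a| <= e) ->
  Re `|cint m (fun z => (k z)%:C * h z) - a| <= 2 * e + eta * A.
Proof.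
move=> ck ch k0 e0 /andP[k1 k2] aA kh.
have ckC : continuous (fun z => (k z)%:C : R[i]^o).
  by apply: continuous_complex => // z; exact: cvg_cst.
have cha : continuous (fun z => (k z)%:C * (h z - a) : R[i]^o).
  move=> z; apply: cvgM; first exact: ckC.
  by apply: cvgB; [exact: ch|exact: cvg_cst].
have -> : cint m (fun z => (k z)%:C * h z) - a =
    cint m (fun z => (k z)%:C * (h z - a)) + a * ((rint m k)%:C - 1).
  have -> : (fun z => (k z)%:C * h z) =
      (fun z => (k z)%:C * (h z - a) + a * (k z)%:C).
    by apply/funext => z; ring.
  rewrite (cintD cX m cha).
    by rewrite (cintZ cX m a ckC) cint_real -[cint m _]/(cint m _); ring.
  by move=> z; apply: cvgM; [exact: cvg_cst|exact: ckC].
rewrite (le_trans (Re_normD _ _))// lerD//.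
  have cke : continuous (fun z => e * k z).
    by move=> z; apply: cvgM; [exact: cvg_cst|exact: ck].
  apply: (le_trans (le_rnorm_cint cX m cha cke _)).
    move=> z; rewrite Re_normM mulrC Re_normC ?k0//.
    have [->|/kh kz] := eqVneq (k z) 0; first by rewrite !mulr0.
    by rewrite ler_wpM2r.
  by rewrite ler_pM2l// (rintZ cX m e ck) ler_piMr.
have -> : (rint m k)%:C - 1 = - (1 - rint m k)%:C.
  by rewrite rmorphB rmorph1 opprB.
rewrite Re_normM mulrC normrN Re_normC ?subr_ge0//.
by rewrite ler_pM ?subr_ge0 ?Re_norm_ge0//; lra.
Qed.

End measure_comparison.

(** * An approximate unit from balls of equal mass *)

Section bump.
Context {R : realType} {X : ptopologicalType}.
Variables (cX : compact [set: X]) (m : probability (borel X) R).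
Variables (d : X -> X -> R) (cd : compatible_metric d) (delta : R).
Local Notation M := (kernel_algebra cX m).
Implicit Types (k n : nat) (x y z : X) (s : R).

(** A piecewise linear cut-off: for positive [k] it is 1 up to [delta] - 1/k and 0 from [delta] on,
    so it increases with [k] to the indicator of [s < delta]. *)
Definition bump k s : R := Num.min 1 (Num.max 0 (k%:R * (delta - s))).

Lemma bump_ge0 k s : 0 <= bump k s.
Proof. by rewrite le_min ler01 le_max lexx. Qed.

Lemma bump_le1 k s : bump k s <= 1.
Proof. by rewrite ge_min lexx. Qed.

Lemma bump_neq0 k s : bump k s != 0 -> s < delta.
Proof.
apply: contraNT; rewrite -leNgt => ds.
rewrite /bump max_l; first by rewrite min_r.
by rewrite mulr_ge0_le0// subr_le0.
Qed.

Lemma bump_eq1 k s : 1 <= k%:R * (delta - s) -> bump k s = 1.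
Proof. by move=> h; rewrite /bump min_l// le_max h orbT. Qed.

Lemma bump_homo k n s : (k <= n)%N -> bump k s <= bump n s.
Proof.
move=> kn; have [ds|sd] := leP delta s; last first.
  rewrite /bump le_min ge_min lexx/= ge_min; apply/orP; right.
  rewrite ge_max !le_max lexx/=; apply/orP; right.
  by rewrite ler_wpM2r ?ler_nat// subr_ge0 ltW.
have -> : bump k s = 0; last exact: bump_ge0.
by apply/eqP; apply: contraLR ds => /bump_neq0; rewrite ltNge.
Qed.

Lemma bump_dist_continuous k :
  continuous (fun p : X * X => bump k (d p.1 p.2)).
Proof.
have cb : continuous (bump k).
  move=> s; apply: (@continuous_min _ _ (fun=> 1)
    (fun s => Num.max 0 (k%:R * (delta - s)))); first exact: cvg_cst.
  apply: (@continuous_max _ _ (fun=> 0) (fun s => k%:R * (delta - s))).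
    exact: cvg_cst.
  apply: cvgM; first exact: cvg_cst.
  by apply: cvgB; [exact: cvg_cst|exact: cvg_id].
move=> p; apply: (@continuous_comp _ _ _ (fun q : X * X => d q.1 q.2) (bump k)).
  exact: dist_continuous.
exact: cb.
Qed.

Lemma bump_dist_continuous_right k x : continuous (fun z => bump k (d x z)).
Proof.
move=> z; apply: (@continuous_comp _ _ _ (fun z => (x, z))
  (fun p : X * X => bump k (d p.1 p.2))); last exact: bump_dist_continuous.
by apply: cvg_pair => /=; [exact: cvg_cst|exact: cvg_id].
Qed.

Variable lambda : R.
Hypothesis delta_gt0 : 0 < delta.
Hypothesis ball_measure : forall x, fine (m [set z | d x z < delta]) = lambda.

Lemma bump_mass_le k x : rint m (fun z => bump k (d x z)) <= lambda.
Proof.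
rewrite -(ball_measure x); apply: (rint_le_measure cX).
- exact: ball_open.
- exact: bump_dist_continuous_right.
- by move=> z; rewrite bump_ge0 bump_le1.
- by move=> z /bump_neq0.
Qed.

(** Continuity of [m] from below along the smaller balls [F k], whose union is the open ball of
    radius [delta]. *)
Lemma bump_mass_cvg x (e : R) : 0 < e ->
  exists k, lambda - e < rint m (fun z => bump k (d x z)).
Proof.
move=> e0; pose F k := [set z | d x z < delta - k.+1%:R^-1].
have mo (A : set X) : open A -> measurable (A : set (borel X)).
  by move=> oA; exact: sub_sigma_algebra.
have mE : m [set z | d x z < delta] = lambda%:E.
  rewrite -(ball_measure x) fineK//; apply: fin_num_measure; apply: mo.
  exact: ball_open.
have UF : \bigcup_k F k = [set z | d x z < delta].
  apply/seteqP; split=> z /=.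
    by move=> [k _] /lt_le_trans; apply; rewrite lerBlDr lerDl.
  move=> xz; exists (Num.truncn (delta - d x z)^-1) => //; rewrite /F/=.
  rewrite ltrBrDr addrC -ltrBrDr invf_plt ?posrE ?subr_gt0//.
  exact: truncnS_gt.
have oF k : open (F k) by exact: ball_open.
have oU : open (\bigcup_k F k) by rewrite UF; exact: ball_open.
have := @nondecreasing_cvg_mu _ _ _ m F (fun k => mo _ (oF k)) (mo _ oU).
have nd : nondecreasing_seq F.
  move=> k n kn; apply/subsetPset => z; rewrite /F/= => /lt_le_trans; apply.
  by rewrite lerD2l lerN2 lef_pV2 ?posrE// ler_nat ltnS.
move=> /(_ nd); rewrite UF [X in _ --> X](_ : _ = lambda%:E)//.
move=> /fine_cvg /cvgrPdist_lt /(_ e e0)[k _ /(_ k (leqnn k))] /=.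
(* The shift matches [F k], on which the bump of index [k.+1] equals 1. *)
rewrite ltr_distlC => /andP[h _]; exists k.+1; apply: (lt_le_trans h).
apply: (@measure_le_rint _ _ cX m (F k)).
- exact: oF.
- exact: bump_dist_continuous_right.
- by move=> z; exact: bump_ge0.
- move=> z; rewrite /F/= => xz; rewrite bump_eq1//.
  by rewrite -ler_pdivrMl// mulr1 ltW// ltrBrDr addrC -ltrBrDr.
Qed.

(* Dini: the masses increase with [k] to the constant [lambda]. *)
Lemma bump_mass_uniform (e : R) : 0 < e -> exists k, 1 <= k%:R * delta /\
  forall x, lambda - e <= rint m (fun z => bump k (d x z)) <= lambda.
Proof.
move=> e0; have /compact_near_coveringP/(_ nat \oo (fun k x =>
    lambda - e <= rint m (fun z => bump k (d x z)))) := cX.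
case=> [x _|N _ NP].
  have [k kx] := bump_mass_cvg x e0.
  have cm : continuous (fun x => rint m (fun z => bump k (d x z))).
    exact: (@continuous_parameter_Rintegral R X cX m X _
      (@bump_dist_continuous k)).
  exists ([set y | lambda - e < rint m (fun z => bump k (d y z))],
          [set n | (k <= n)%N]) => /=.
    split; last by exists k.
    by move: (cm x) => /cvgr_gt; apply.
  move=> [y n] /= [ky kn]; rewrite (le_trans (ltW ky))//.
  apply: (le_rint cX); [exact: bump_dist_continuous_right..|].
  by move=> z; exact: bump_homo.
(* The second entry of the maximum makes the bump equal to 1 at distance 0, which later fixes the
   trace. *)
exists (maxn N (Num.truncn delta^-1).+1); split; last first.
  by move=> x; rewrite bump_mass_le andbT; apply: NP => //=; exact: leq_maxl.
rewrite -ler_pdivrMr// mul1r ltW// (lt_le_trans (truncnS_gt _))//.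
by rewrite ler_nat leq_maxr.
Qed.

End bump.

(** * Normalised bump kernels and their finite-rank perturbations *)

Section approximate_unit.
Context {R : realType} {X : ptopologicalType}.
Variables (cX : compact [set: X]) (m : probability (borel X) R).
Variables (d : X -> X -> R) (cd : compatible_metric d) (delta : nat -> R).
Hypothesis full_support : measure_support m = [set: X].
Hypothesis radii : homogeneous_radii m d delta.
Local Notation M := (kernel_algebra cX m).
Implicit Types (f g : M) (x y z : X) (n : nat).

Let ball_mass n : R := fine (m [set z | d point z < delta n]).

Let ball_massE n x : fine (m [set z | d x z < delta n]) = ball_mass n.
Proof. by case: radii => _ _ _ _ h; rewrite (h n x point). Qed.

Let delta_gt0 n : 0 < delta n. Proof. by case: radii. Qed.

Let delta_small (r : R) : 0 < r ->
  exists N, forall n, (N <= n)%N -> delta n < r.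
Proof.
move=> r0; case: radii => nd _ inf0 _ _.
have hinf : has_inf (range delta).
  by split; [exists (delta 0), 0|exists 0 => _ [n _ <-]; exact: ltW].
have [_ [N _ <-]] := inf_adherent r0 hinf; rewrite inf0 add0r => Nr.
by exists N => n Nn; exact: le_lt_trans (nd _ _ Nn) Nr.
Qed.

Let measurable_ball n :
  measurable ([set z | d point z < delta n] : set (borel X)).
Proof. by apply: sub_sigma_algebra; exact: ball_open. Qed.

Let ball_mass_gt0 n : 0 < ball_mass n.
Proof.
apply: fine_gt0; apply/andP; split; last first.
  by rewrite (le_lt_trans (probability_le1 m (measurable_ball n)))// ltry.
have : measure_support m point by rewrite full_support.
by apply; [exact: ball_open|rewrite /= dist_xx].
Qed.

Let ball_mass_le1 n : ball_mass n <= 1.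
Proof.
rewrite -lee_fin fineK; first exact: probability_le1 (measurable_ball n).
by apply: fin_num_measure; exact: measurable_ball.
Qed.

(** The kernel is a bump of the distance divided by the common ball mass. As this mass does not
    depend on the center, the kernel is symmetric and averages almost exactly on both sides, and its
    constant diagonal value, also its maximum, is its trace. *)
Lemma bump_kernel_unit n : exists2 u : M,
  [/\ multiplier_bound u 2, trace u = ((ball_mass n)^-1)%:C &
      rnorm u <= (ball_mass n)^-1] &
  forall f (e : R), 0 <= e ->
    (forall x x' y, d x x' < delta n -> Re `|f (x, y) - f (x', y)| <= e) ->
    (forall x y y', d y y' < delta n -> Re `|f (x, y) - f (x, y')| <= e) ->
    rnorm (u ** f - f) <= 2 * e + n.+1%:R^-1 * rnorm f /\
    rnorm (f ** u - f) <= 2 * e + n.+1%:R^-1 * rnorm f.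
Proof.
have l0 := ball_mass_gt0 n; set l := ball_mass n in l0 *.
(* After division by [l], this tolerance becomes the mass defect 1/(n+1). *)
have ln0 : 0 < l / n.+1%:R by rewrite divr_gt0.
have [k [kd kP]] := bump_mass_uniform cX cd (delta_gt0 n) (ball_massE n) ln0.
pose w x z := l^-1 * bump (delta n) k (d x z).
have w0 x z : 0 <= w x z by rewrite mulr_ge0 ?bump_ge0// invr_ge0 ltW.
have wC x z : w x z = w z x by rewrite /w (dist_sym cd).
have wl x z : w x z <= l^-1 by rewrite ler_piMr ?bump_le1// invr_ge0 ltW.
have cw : continuous (fun p : X * X => w p.1 p.2).
  move=> p; apply: cvgM; first exact: cvg_cst.
  exact: bump_dist_continuous.
have cwx x : continuous (w x).
  move=> z; apply: cvgM; first exact: cvg_cst.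
  exact: bump_dist_continuous_right.
have cu : continuous (fun p : X * X => (w p.1 p.2)%:C : R[i]^o).
  by apply: continuous_complex => // p; exact: cvg_cst.
have wmass x : 1 - n.+1%:R^-1 <= rint m (w x) <= 1.
  rewrite (rintZ cX m _ (@bump_dist_continuous_right _ _ _ cd _ k x)).
  have /andP[h1 h2] := kP x; apply/andP; split.
    by rewrite -ler_pdivrMl ?invr_gt0// invrK mulrBr mulr1.
  by rewrite -ler_pdivlMl ?invr_gt0// invrK mulr1.
have wd x z : w x z != 0 -> d x z < delta n.
  by rewrite mulf_eq0 negb_or => /andP[_ /bump_neq0].
pose u : M := kernel_of cX m cu.
have uf f x y : (u ** f) (x, y) = cint m (fun z => (w x z)%:C * f (z, y)) by [].
have fu f x y : (f ** u) (x, y) = cint m (fun z => (w y z)%:C * f (x, z)).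
  rewrite kernel_mulE; congr cint; apply/funext => z.
  by rewrite mulrC wC.
have mean (h : X -> R[i]^o) x (A : R) : continuous h -> 0 <= A ->
    (forall z, Re `|h z| <= A) ->
    Re `|cint m (fun z => (w x z)%:C * h z)| <= 2 * A.
  move=> ch A0 hA; have cA : continuous (fun z => A * w x z).
    by move=> z; apply: cvgM; [exact: cvg_cst|exact: cwx].
  have ck : continuous (fun z => (w x z)%:C * h z : R[i]^o).
    move=> z; apply: cvgM; last exact: ch.
    by apply: continuous_complex => // z'; exact: cvg_cst.
  apply: (le_trans (le_rnorm_cint cX m ck cA _)).
    by move=> z; rewrite Re_normM mulrC Re_normC// ler_wpM2r.
  rewrite ler_pM2l// (rintZ cX m _ (cwx x)) ler_piMr//.
  by case/andP: (wmass x).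
exists u; first split.
- move=> f; split; apply: rnorm_kernel_le => x y.
    rewrite uf; apply: mean; rewrite ?rnorm_ge0//.
      exact: kernel_continuous_right.
    by move=> z; exact: rnorm_kernel_ge.
  rewrite fu; apply: mean; rewrite ?rnorm_ge0//.
    exact: kernel_continuous_left.
  by move=> z; exact: rnorm_kernel_ge.
- rewrite /trace -[RHS](cint_cst m); congr cint; apply/funext => z.
  rewrite [LHS]/((w z z)%:C) /w (dist_xx cd) bump_eq1 ?mulr1//.
  by rewrite subr0.
- apply: rnorm_kernel_le => x y.
  by rewrite [X in Re `|X|]/((w x y)%:C) Re_normC.
move=> f e e0 fl fr; split; apply: rnorm_kernel_le => x y.
  rewrite kernelDE kernelNE uf; apply: (weighted_mean cX).
  - exact: cwx.
  - exact: kernel_continuous_right.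
  - exact: w0.
  - exact: e0.
  - exact: wmass.
  - exact: rnorm_kernel_ge.
  - by move=> z /wd xz; rewrite distrC; exact: fl.
rewrite kernelDE kernelNE fu; apply: (weighted_mean cX).
- exact: cwx.
- exact: kernel_continuous_left.
- exact: w0.
- exact: e0.
- exact: wmass.
- exact: rnorm_kernel_ge.
- by move=> z /wd xz; rewrite distrC; exact: fr.
Qed.

(** Each bump kernel is replaced by a finite-rank one so close in supremum norm that multiplier
    bound, trace and norm change only by small absolute amounts. *)
Lemma finite_rank_approximate_unit : exists p : nat -> seq (M * M),
  [/\ forall n, col_row (p n),
      approximate_unit_seq (@kernel_mul R X cX m) (fun n => tensor (p n)),
      forall n, multiplier_bound (tensor (p n)) 4 &
      forall n, 0 < rnorm (tensor (p n)) <= 4 * Re `|trace (tensor (p n))|].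
Proof.
have /choice[u uP] : forall n, exists u : M,
    [/\ multiplier_bound u 2, trace u = ((ball_mass n)^-1)%:C,
      rnorm u <= (ball_mass n)^-1 &
      forall f (e : R), 0 <= e ->
      (forall x x' y, d x x' < delta n -> Re `|f (x, y) - f (x', y)| <= e) ->
      (forall x y y', d y y' < delta n -> Re `|f (x, y) - f (x, y')| <= e) ->
      rnorm (u ** f - f) <= 2 * e + n.+1%:R^-1 * rnorm f /\
      rnorm (f ** u - f) <= 2 * e + n.+1%:R^-1 * rnorm f].
  by move=> n; have [u [? ? ?] ?] := bump_kernel_unit n; exists u.
(* The 1/(n+1) makes the perturbation vanish in the limit; the 1/4 keeps the trace error at most
   1/2. *)
have eps0 n : 0 < (4 * n.+1%:R)^-1 :> R by rewrite invr_gt0 mulr_gt0.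
have /choice[p pP] : forall n, exists t : seq (M * M),
    col_row t /\ rnorm (u n - tensor t) <= (4 * n.+1%:R)^-1.
  by move=> n; have [t] := finite_rank_dense cd (u n) (eps0 n); exists t.
have eps_le n : (4 * n.+1%:R)^-1 <= 4^-1 :> R.
  by rewrite lef_pV2 ?posrE ?mulr_gt0// ler_pMr// ler1n.
have tE n : tensor (p n) = u n - (u n - tensor (p n)) by rewrite subKr.
have rl n f :
    rnorm ((u n - tensor (p n)) ** f) <= 2 * (4 * n.+1%:R)^-1 * rnorm f.
  rewrite (le_trans (rnorm_kernel_mul _ _))// ler_wpM2r ?rnorm_ge0//.
  by rewrite ler_pM2l//; case: (pP n).
have rr n f :
    rnorm (f ** (u n - tensor (p n))) <= 2 * (4 * n.+1%:R)^-1 * rnorm f.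
  rewrite (le_trans (rnorm_kernel_mul _ _))// mulrAC ler_wpM2r ?rnorm_ge0//.
  by rewrite ler_pM2l//; case: (pP n).
have ml n f : tensor (p n) ** f = u n ** f - (u n - tensor (p n)) ** f.
  by rewrite {1}tE kernel_mulDl kernel_mulNl.
have mr n f : f ** tensor (p n) = f ** u n - f ** (u n - tensor (p n)).
  by rewrite {1}tE kernel_mulDr kernel_mulNr.
exists p; split.
- by move=> n; case: (pP n).
- move=> f; suff H (e : R) : 0 < e -> exists N, forall n, (N <= n)%N ->
      rnorm (f ** tensor (p n) - f) <= e /\ rnorm (tensor (p n) ** f - f) <= e.
    split; apply/cvg_rnormP => e e0; have [N NP] := H e e0.
      by exists N => n /NP[h _]; exact: h.
    by exists N => n /NP[_ h]; exact: h.
  (* The budget is twice e/8 for the oscillation of [f], e/8 for the mass defect and e/8 for the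
     perturbation. *)
  move=> e0; have e80 : 0 < e / 8 by rewrite divr_gt0.
  have cf := @kernel_continuous _ _ _ _ f.
  have [r r0 rP] := uniformly_continuous_left cX cd cf e80.
  have [s s0 sP] := uniformly_continuous_right cX cd cf e80.
  have [N NP] := delta_small r0; have [N' NP'] := delta_small s0.
  exists (maxn (maxn N N') (Num.truncn (rnorm f / (e / 8)))) => n.
  rewrite !geq_max => /andP[/andP[/NP nr /NP' ns] nf].
  have fn : n.+1%:R^-1 * rnorm f <= e / 8.
    rewrite ler_pdivrMl// -ler_pdivrMr// ltW// (lt_le_trans (truncnS_gt _))//.
    by rewrite ler_nat ltnS.
  have fn2 : 2 * (4 * n.+1%:R)^-1 * rnorm f <= e / 8.
    rewrite (_ : _ * _ = 2^-1 * (n.+1%:R^-1 * rnorm f)); last first.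
      by field; rewrite nat1r pnatr_eq0.
    have : 0 <= n.+1%:R^-1 * rnorm f by rewrite mulr_ge0 ?rnorm_ge0.
    move: (n.+1%:R^-1 * rnorm f) fn => v.
    lra.
  have [_ _ _ /(_ f (e / 8) (ltW e80))[||ul ur]] := uP n.
  - by move=> x x' y xx'; apply: rP; exact: lt_trans xx' nr.
  - by move=> x y y' yy'; apply: sP; exact: lt_trans yy' ns.
  have close (a b c v : R) : a <= 2 * (e / 8) + v -> v <= e / 8 ->
    b <= e / 8 -> c <= a + b -> c <= e by lra.
  rewrite mr ml; split; rewrite addrAC.
    exact: close ur fn (le_trans (rr n f) fn2) (rnormB _ _).
  exact: close ul fn (le_trans (rl n f) fn2) (rnormB _ _).
- move=> n f; have [/(_ f)[h1 h2] _ _ _] := uP n.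
  have hh : 2 * (4 * n.+1%:R)^-1 * rnorm f <= rnorm f.
    rewrite ler_piMl ?rnorm_ge0//.
    by move: (eps_le n); move: ((4 * _)^-1) => v; lra.
  have close (a b c v : R) : 0 <= v -> a <= 2 * v -> b <= v -> c <= a + b ->
    c <= 4 * v by lra.
  rewrite ml mr; split.
    exact: close (rnorm_ge0 f) h1 (le_trans (rl n f) hh) (rnormB _ _).
  exact: close (rnorm_ge0 f) h2 (le_trans (rr n f) hh) (rnormB _ _).
- move=> n; have [_ tr un _] := uP n; have [ct te] := pP n.
  (* Since the inverse mass [l] is at least 1, l + 1/4 is at most 4 (l - 1/2); this gives the ratio
     4, and a trace of modulus at least 1/2 forces a nonzero kernel. *)
  have li : 1 <= (ball_mass n)^-1 by rewrite invf_ge1.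
  have te4 := le_trans te (eps_le n).
  set l := (ball_mass n)^-1 in tr un li.
  have tru : Re `|trace (u n - tensor (p n))| <= 2^-1.
    by apply: (le_trans (trace_le _)); move: te4; move: (rnorm _) => v; lra.
  have trE : l%:C = trace (tensor (p n)) + trace (u n - tensor (p n)).
    by rewrite -tr -traceD addrC subrK.
  have lt : l <= Re `|trace (tensor (p n))| + 2^-1.
    rewrite -[leLHS](@Re_normC _ l) ?trE ?(le_trans _ li)//.
    by rewrite (le_trans (Re_normD _ _))// lerD2l.
  have tn : rnorm (tensor (p n)) <= l + 4^-1.
    by rewrite tE (le_trans (rnormB _ _))// lerD.
  have tt : Re `|trace (tensor (p n))| <= 2 * rnorm (tensor (p n)).
    exact: trace_le.
  have close (a b : R) : l <= a + 2^-1 -> b <= l + 4^-1 -> a <= 2 * b ->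
    0 < b <= 4 * a by move=> *; apply/andP; split; lra.
  exact: close lt tn tt.
Qed.

End approximate_unit.

Theorem theorem7p1 (R : realType) (X : ptopologicalType)
    (cX : compact [set: X])
    (metrizableX : exists d : X -> X -> R, compatible_metric d)
    (m : probability (borel X) R)
    (full_support : measure_support m = [set: X])
    (radii : exists d : X -> X -> R, compatible_metric d /\
       exists delta : nat -> R, homogeneous_radii m d delta)
    (E : completeNormedModType R[i])
    (B : banach_bimodule (@kernel_mul R X cX m) E)
    (injective_cont :
       injectively_continuous (fun a w b => ract B (lact B a w) b))
    (unit_cvg : forall u : nat -> kernel_algebra cX m,
       approximate_unit_seq (@kernel_mul R X cX m) u ->
       forall w : E, lact B (u n) w @[n --> \oo] --> w)
    (D : {linear kernel_algebra cX m -> E}) :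
  bounded_operator D -> derivation B D ->
  sequentially_approximately_inner B D.
Proof.
move=> D_bounded D_derivation; have [d [cd [delta radii_delta]]] := radii.
have [p [p_col_row p_unit p_bound p_trace]] :=
  finite_rank_approximate_unit cX cd full_support radii_delta.
(* The constant [K] is 4 here, both as multiplier bound and as ratio of norm to trace. *)
exact: (derivation_approximately_inner D_derivation injective_cont unit_cvg
  D_bounded p_col_row p_unit p_bound p_trace).
Qed.
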